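(* Consider the parameter-dependent nonlinear affine dynamical system $$\dot x(t)=f(x(t),\theta_f)+G(x(t),\theta_G)u(t)+K(x(t),\theta_K)a(t),\quad x(0)=x_0,\quad t\ge0,$$ with cost functional $$J(x_0,\theta_{\mathrm s},u(\cdot),a(\cdot))=\int_0^{T_{\mathrm p}}\Big(L(x(t))+L_u(x(t))u(t)+L_a(x(t))a(t)+u^{\mathrm T}(t)R_u(x(t))u(t)-a^{\mathrm T}(t)R_a(x(t))a(t)\Big)\mathrm dt,$$ where the controller $u(\cdot)$ is a player that minimizes $J$ and the adversary $a(\cdot)$ is a player that maximizes $J$. Let $\mathcal S\subset\mathbb R^n$ be a set of admissible states with $0\in\mathcal S$ and let $T_{\mathrm p}>0$ be a predefined time. For every $x_0\in\mathcal S$, let $\mathcal F(x_0,\mathcal S,T_{\mathrm p})\subset\mathcal U\times\mathcal A$ be the set of safely predefined-time stabilizing pairs of feedback strategies and suppose that it is nonempty. Assume that there exist a continuously differentiable function $V:\mathcal S\to\mathbb R$, continuous functions $L_u:\mathcal S\to\mathbb R^{1\times m_u}$ and $L_a:\mathcal S\to\mathbb R^{1\times m_a}$ with $L_u(0)=0$ and $L_a(0)=0$, continuous positive-definite matrix functions $R_u:\mathcal S\to\mathbb R^{m_u\times m_u}$ and $R_a:\mathcal S\to\mathbb R^{m_a\times m_a}$, system parameter vectors $\theta_f\in\mathbb R^{N_f}$, $\theta_G\in\mathbb R^{N_G}$, $\theta_K\in\mathbb R^{N_K}$, and real numbers $\alpha,\beta,p,q,r>0$ such that $pr<1$, $qr>1$,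 and \begin{align*} & V(0)=0,\qquad V(x)>0,\ x\in\mathcal S\setminus\{0\},\qquad V(x)\to\infty\text{ as }x\to\partial\mathcal S,\\ & V'(x)\Big[f(x,\theta_f)-\tfrac12G(x,\theta_G)R_u^{-1}(x)L_u^{\mathrm T}(x)+\tfrac12K(x,\theta_K)R_a^{-1}(x)L_a^{\mathrm T}(x)\\ &\qquad-\tfrac12G(x,\theta_G)R_u^{-1}(x)G^{\mathrm T}(x,\theta_G)V'^{\mathrm T}(x)+\tfrac12K(x,\theta_K)R_a^{-1}(x)K^{\mathrm T}(x,\theta_K)V'^{\mathrm T}(x)\Big]\\ &\qquad\le-\frac{\gamma}{T_{\mathrm p}}\big(\alpha V^p(x)+\beta V^q(x)\big)^r,\quad x\in\mathcal S, \end{align*} where $$\gamma=\frac{\Gamma\!\left(\frac{1-rp}{q-p}\right)\Gamma\!\left(\frac{rq-1}{q-p}\right)}{\alpha^r\,\Gamma(r)\,(q-p)}\left(\frac{\alpha}{\beta}\right)^{\frac{1-rp}{q-p}} .$$ If either $\mathcal S$ is bounded, or $\mathcal S$ is unbounded and $V$ is coercive, then with the feedback control strategy $$u(t)=u^\star(x(t),\theta_{\mathrm c})=-\tfrac12R_u^{-1}(x(t))\big[L_u(x(t))+V'(x(t))G(x(t),\theta_G)\big]^{\mathrm T},\quad x(t)\in\mathcal S,\ t\ge0,$$ and the feedback adversary strategy $$a(t)=a^\star(x(t),\theta_{\mathrm a})=\tfrac12R_a^{-1}(x(t))\big[L_a(x(t))+V'(x(t))K(x(t),\theta_K)\big]^{\mathrm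 T},\quad x(t)\in\mathcal S,\ t\ge0,$$ the zero solution $x(t)\equiv0$ of the resulting closed-loop system is safely predefined-time stable with predefined time $T_{\mathrm p}$ with respect to $\mathcal S$; the cost functional $J$ with $$L(x)=u^{\star\mathrm T}(x,\theta_{\mathrm c})R_u(x)u^\star(x,\theta_{\mathrm c})-V'(x)f(x,\theta_f)-a^{\star\mathrm T}(x,\theta_{\mathrm a})R_a(x)a^\star(x,\theta_{\mathrm a}),\quad x\in\mathcal S,$$ has a saddle point in the sense that, for $x_0\in\mathcal S$, \begin{align*} J(x_0,\theta_{\mathrm s},u^\star(x(\cdot),\theta_{\mathrm c}),a^\star(x(\cdot),\theta_{\mathrm a})) &=\min_{u(\cdot)\in\mathcal F_u(x_0,\mathcal S,T_{\mathrm p})}\ \max_{a(\cdot)\in\mathcal F_a(x_0,\mathcal S,T_{\mathrm p})}J(x_0,\theta_{\mathrm s},u(\cdot),a(\cdot))\\ &=\max_{a(\cdot)\in\mathcal F_a(x_0,\mathcal S,T_{\mathrm p})}\ \min_{u(\cdot)\in\mathcal F_u(x_0,\mathcal S,T_{\mathrm p})}J(x_0,\theta_{\mathrm s},u(\cdot),a(\cdot)); \end{align*} and the Nash value is $J(x_0,\theta_{\mathrm s},u^\star(x(\cdot),\theta_{\mathrm c}),a^\star(x(\cdot),\theta_{\mathrm a}))=V(x_0)$.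
   Context: System. $f:\mathbb R^n\times\mathbb R^{N_f}\to\mathbb R^n$, $G:\mathbb R^n\times\mathbb R^{N_G}\to\mathbb R^{n\times m_u}$, $K:\mathbb R^n\times\mathbb R^{N_K}\to\mathbb R^{n\times m_a}$ are continuous in the first argument for every value of the parameter, and $f(0,\cdot)=0$. The system parameter vector is $\theta_{\mathrm s}=[\theta_f^{\mathrm T},\theta_G^{\mathrm T},\theta_K^{\mathrm T}]^{\mathrm T}$. Controls take values in $\mathbb R^{m_u}$ and adversary inputs in $\mathbb R^{m_a}$. Admissible controls and adversaries: $\mathcal U=\{u:[0,\infty)\to\mathbb R^{m_u}\text{ Lebesgue measurable}\}$, $\mathcal A=\{a:[0,\infty)\to\mathbb R^{m_a}\text{ Lebesgue measurable}\}$. It is a standing assumption that the required properties for existence and uniqueness of solutions of the controlled system are satisfied; $s(t,x_0,\theta_{\mathrm s},u(\cdot),a(\cdot))$, $t\ge0$, denotes the solution. Strategies. A control strategy is a map $u^\star:\mathcal S\times\mathbb R^{N_{\mathrm c}}\to\mathbb R^{m_u}$ with $u^\star(\cdot,\theta_{\mathrm c})$ Lebesgue measurable on $\mathcal S$ for every control parameter vector $\theta_{\mathrm c}\in\mathbb R^{N_{\mathrm c}}$ and $u^\star(0,\cdot)=0$; an adversary strategy $a^\star:\mathcal S\times\mathbb R^{N_{\mathrm a}}\to\mathbb R^{m_a}$ is defined analogously, with adversary parameter vector $\theta_{\mathrm a}\in\mathbb R^{N_{\mathrm a}}$. If $u(t)=u^\star(x(t),\theta_{\mathrm c})$ and $a(t)=a^\star(x(t),\theta_{\mathrm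 a})$, $t\ge0$, where $x(t)$ solves the controlled system, then $u(\cdot)$ is called a feedback control strategy and $a(\cdot)$ a feedback adversary strategy. In the claim, $\theta_{\mathrm c}$ and $\theta_{\mathrm a}$ merely collect the parameters appearing in the displayed formulas for $u^\star$ and $a^\star$. Safe predefined-time stability. For $\dot x=\phi(x,\theta)$, $x(0)=x_0$, with $\phi(0,\cdot)=0$ and solution $s(t,x_0,\theta)$, the zero solution is safely predefined-time stable with predefined time $T_{\mathrm p}$ with respect to $\mathcal S$ if there exists a parameter $\theta$ such that for every $x_0\in\mathcal S$ the solution satisfies $\operatorname{dist}(s(t,x_0,\theta),\mathcal S)\equiv0$ (which expresses that $\mathcal S$ is positively invariant) and $s(t,x_0,\theta)=0$ for all $t\ge T_{\mathrm p}$. Here $\operatorname{dist}(y,C)=\inf_{x\in C}\|y-x\|$. The closed-loop system is regarded as such a system with $\theta=[\theta_{\mathrm s}^{\mathrm T},\theta_{\mathrm c}^{\mathrm T},\theta_{\mathrm a}^{\mathrm T}]^{\mathrm T}$ and $\phi(x,\theta)=f(x,\theta_f)+G(x,\theta_G)u^\star(x,\theta_{\mathrm c})+K(x,\theta_K)a^\star(x,\theta_{\mathrm a})$. Strategy sets. For $x_0\in\mathcal S$, $\mathcal F(x_0,\mathcal S,T_{\mathrm p})\subset\mathcal U\times\mathcal A$ is the set of pairs $(u(\cdot),a(\cdot))$ of a feedback control strategy and a feedback adversary strategy such that the solution of the controlled system (with the system parameter $\theta_{\mathrm s}$ under consideration) satisfies $\operatorname{dist}(s(t,x_0,\theta_{\mathrm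 s},u(\cdot),a(\cdot)),\mathcal S)\equiv0$ (that is, the solution remains in $\mathcal S$) and $s(t,x_0,\theta_{\mathrm s},u(\cdot),a(\cdot))=0$ for all $t\ge T_{\mathrm p}$. The sets $\mathcal F_u(x_0,\mathcal S,T_{\mathrm p})\subset\mathcal U$ and $\mathcal F_a(x_0,\mathcal S,T_{\mathrm p})\subset\mathcal A$ are the sets of feedback control strategies and feedback adversary strategies such that $\mathcal F_u(x_0,\mathcal S,T_{\mathrm p})\times\mathcal F_a(x_0,\mathcal S,T_{\mathrm p})=\mathcal F(x_0,\mathcal S,T_{\mathrm p})$. Other notation. $V'(x)$ is the gradient of $V$ as a row vector; $\Gamma$ is the gamma function; $\partial\mathcal S$ is the boundary of $\mathcal S$. For unbounded $\mathcal S$, $V:\mathcal S\to\mathbb R$ is coercive if $V(x_k)\to\infty$ for every sequence $\{x_k\}$ in $\mathcal S$ with $\|x_k\|\to\infty$. *)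

(* Defs.v *)
From HB Require Import structures.
From mathcomp Require Import all_boot all_order all_algebra.
From mathcomp Require Import all_classical all_reals all_analysis.

Set Implicit Arguments.
Unset Strict Implicit.
Unset Printing Implicit Defensive.

Import Order.TTheory GRing.Theory Num.Theory.
Import numFieldNormedType.Exports.

Local Open Scope classical_set_scope.
Local Open Scope ring_scope.

(* Vectors of R^n are columns 'cV[R]_n, whose library norm is the maximum norm.
   Boundedness, coercivity and the zero set of the distance are the same as for
   the Euclidean norm. Functions on a set S of states are total functions of
   which only the values on S matter. *)

Section linear_algebra_and_calculus.
Context {R : realType}.

Definition symmetric_posdef m (M : 'M[R]_m) : Prop :=
  M^T = M /\ forall v : 'cV[R]_m, v != 0 -> 0 < (v^T *m M *m v) 0 0.

Definition gradient n (V : 'cV[R]_n -> R) (x : 'cV[R]_n) : 'rV[R]_n :=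
  \row_j 'D_(delta_mx j 0) V x.

Definition continuously_differentiable n (S : set 'cV[R]_n)
    (V : 'cV[R]_n -> R) : Prop :=
  (forall x, S x -> differentiable V x) /\ {within S, continuous (gradient V)}.

Definition boundary n (S : set 'cV[R]_n) : set 'cV[R]_n :=
  closure S `\` interior S.

(* The limit is taken within S and the point z is not deleted. If z were in S,
   then V z would have to exceed every bound, so the property makes S open. *)
Definition blows_up_at_boundary n (S : set 'cV[R]_n)
    (V : 'cV[R]_n -> R) : Prop :=
  forall z, boundary S z -> V x @[x --> within S (nbhs z)] --> +oo.

Definition coercive n (S : set 'cV[R]_n) (V : 'cV[R]_n -> R) : Prop :=
  forall x : nat -> 'cV[R]_n, (forall k, S (x k)) ->
    `|x k| @[k --> \oo] --> +oo -> V (x k) @[k --> \oo] --> +oo.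

Definition dist n (y : 'cV[R]_n) (C : set 'cV[R]_n) : R :=
  inf [set `|y - x| | x in C].

Definition Gamma (z : R) : R :=
  \int[lebesgue_measure]_(t in `]0, +oo[) (t `^ (z - 1) * expR (- t)).

Definition predefined_time_gain (alpha beta p q r : R) : R :=
  Gamma ((1 - r * p) / (q - p)) * Gamma ((r * q - 1) / (q - p)) /
    (alpha `^ r * Gamma r * (q - p)) *
  (alpha / beta) `^ ((1 - r * p) / (q - p)).

End linear_algebra_and_calculus.

Section lebesgue_measurability.
Context {R : realType}.

Definition null_set n (N : set 'cV[R]_n) : Prop :=
  forall e : R, 0 < e ->
    exists (D : set nat) (lo hi : nat -> 'cV[R]_n),
      [/\ forall k i, lo k i 0 <= hi k i 0,
          N `<=` \bigcup_(k in D)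
                   [set x | forall i, lo k i 0 <= x i 0 <= hi k i 0] &
          (\esum_(k in D) (\prod_i (hi k i 0 - lo k i 0))%:E < e%:E)%E].

(* The Lebesgue sigma-algebra is the completion of the Borel sigma-algebra. *)
Definition lebesgue_measurable_set n (E : set 'cV[R]_n) : Prop :=
  exists B N, [/\ <<s [set A : set 'cV[R]_n | open A] >> B,
                  null_set N & E = B `|` N].

Definition lebesgue_measurable_on n m (S : set 'cV[R]_n)
    (g : 'cV[R]_n -> 'cV[R]_m) : Prop :=
  forall A : set 'cV[R]_m, open A -> lebesgue_measurable_set (S `&` g @^-1` A).

(* R with the sigma-algebra of Lebesgue measurable sets; the sigma-algebra that
   the library attaches to R itself is the Borel one. *)
Definition lebesgue_line : measurableType _ :=
  caratheodory_type (@wlength R idfun)^*%mu.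

Definition admissible_signal m (u : R -> 'cV[R]_m) : Prop :=
  forall i, measurable_fun (`[0%R, +oo[ : set lebesgue_line)
              (fun t : lebesgue_line => u t i 0).

End lebesgue_measurability.

Section solutions.
Context {R : realType}.
Local Notation lambda := (@completed_lebesgue_measure R).

(* Caratheodory solution on [0, tau) of x' = F(x), x(0) = x0, in integral form:
   x is absolutely continuous and satisfies the equation almost everywhere. *)
Definition solution_on n (F : 'cV[R]_n -> 'cV[R]_n) (x0 : 'cV[R]_n)
    (tau : \bar R) (x : R -> 'cV[R]_n) : Prop :=
  forall t, 0 <= t -> (t%:E < tau)%E -> forall i,
    lambda.-integrable `[0, t] (fun s => (F (x s) i 0)%:E) /\
    x t i 0 = x0 i 0 + \int[lambda]_(s in `[0, t]) F (x s) i 0.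

Definition locally_solvable n (F : 'cV[R]_n -> 'cV[R]_n) (x0 : 'cV[R]_n) :
    Prop :=
  exists (tau : R) (x : R -> 'cV[R]_n), 0 < tau /\ solution_on F x0 tau%:E x.

Definition uniquely_solvable n (F : 'cV[R]_n -> 'cV[R]_n) (x0 : 'cV[R]_n) :
    Prop :=
  forall (tau : R) (x y : R -> 'cV[R]_n),
    solution_on F x0 tau%:E x -> solution_on F x0 tau%:E y ->
    forall t, 0 <= t < tau -> x t = y t.

Definition is_the_solution n (F : 'cV[R]_n -> 'cV[R]_n) (x0 : 'cV[R]_n)
    (x : R -> 'cV[R]_n) : Prop :=
  solution_on F x0 +oo%E x /\ uniquely_solvable F x0.

(* The notation s(t, x0); meaningful when is_the_solution has a witness. *)
Definition the_solution n (F : 'cV[R]_n -> 'cV[R]_n) (x0 : 'cV[R]_n) :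
    R -> 'cV[R]_n :=
  get [set x | is_the_solution F x0 x].

(* dist = 0 alone only says that x stays in the closure of S. *)
Definition remains_in n (S : set 'cV[R]_n) (x : R -> 'cV[R]_n) : Prop :=
  forall t, 0 <= t -> S (x t) /\ dist (x t) S = 0.

Definition vanishes_from n (Tp : R) (x : R -> 'cV[R]_n) : Prop :=
  forall t, Tp <= t -> x t = 0.

(* The parameter whose existence the notion asks for is the argument theta. *)
Definition safely_predefined_time_stable_at n (Theta : Type)
    (S : set 'cV[R]_n) (Tp : R) (phi : 'cV[R]_n -> Theta -> 'cV[R]_n)
    (theta : Theta) : Prop :=
  (forall theta', phi 0 theta' = 0) /\
  forall x0, S x0 ->
    let x := the_solution (phi^~ theta) x0 in
    [/\ is_the_solution (phi^~ theta) x0 x, remains_in S x &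
        vanishes_from Tp x].

End solutions.

Section differential_game.
Context {R : realType} {n mu ma : nat}.

Definition dynamics {Nf NG NK : nat}
    (f : 'cV[R]_n -> 'cV[R]_Nf -> 'cV[R]_n)
    (G : 'cV[R]_n -> 'cV[R]_NG -> 'M[R]_(n, mu))
    (K : 'cV[R]_n -> 'cV[R]_NK -> 'M[R]_(n, ma))
    (thetas : 'cV[R]_Nf * 'cV[R]_NG * 'cV[R]_NK)
    (x : 'cV[R]_n) (u : 'cV[R]_mu) (a : 'cV[R]_ma) : 'cV[R]_n :=
  f x thetas.1.1 + G x thetas.1.2 *m u + K x thetas.2 *m a.

Definition closed_loop (F : 'cV[R]_n -> 'cV[R]_mu -> 'cV[R]_ma -> 'cV[R]_n)
    (u : 'cV[R]_n -> 'cV[R]_mu) (a : 'cV[R]_n -> 'cV[R]_ma) (x : 'cV[R]_n) :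
    'cV[R]_n :=
  F x (u x) (a x).

Definition feedback_law m (S : set 'cV[R]_n) (k : 'cV[R]_n -> 'cV[R]_m) : Prop :=
  lebesgue_measurable_on S k /\ k 0 = 0.

(* The set of safely predefined-time stabilizing pairs. A feedback strategy is
   represented by its law k, the signal played being t |-> k (x t) along the
   solution x that the pair generates: when one player deviates, the signal of
   the other one follows the new trajectory. *)
Definition stabilizing_pairs
    (F : 'cV[R]_n -> 'cV[R]_mu -> 'cV[R]_ma -> 'cV[R]_n)
    (S : set 'cV[R]_n) (Tp : R) (x0 : 'cV[R]_n) :
    set (('cV[R]_n -> 'cV[R]_mu) * ('cV[R]_n -> 'cV[R]_ma)) :=
  [set ua | let x := the_solution (closed_loop F ua.1 ua.2) x0 in
    [/\ feedback_law S ua.1 /\ feedback_law S ua.2,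
        is_the_solution (closed_loop F ua.1 ua.2) x0 x,
        admissible_signal (ua.1 \o x) /\ admissible_signal (ua.2 \o x),
        remains_in S x &
        vanishes_from Tp x]].

(* An integral of the form oo - oo is -oo by the convention of the library. *)
Definition cost (Tp : R) (L : 'cV[R]_n -> R) (Lu : 'cV[R]_n -> 'rV[R]_mu)
    (La : 'cV[R]_n -> 'rV[R]_ma) (Ru : 'cV[R]_n -> 'M[R]_mu)
    (Ra : 'cV[R]_n -> 'M[R]_ma)
    (x : R -> 'cV[R]_n) (u : R -> 'cV[R]_mu) (a : R -> 'cV[R]_ma) : \bar R :=
  (\int[@completed_lebesgue_measure R]_(t in `[0%R, Tp])
    (L (x t) + (Lu (x t) *m u t) 0 0 + (La (x t) *m a t) 0 0
     + ((u t)^T *m Ru (x t) *m u t) 0 0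
     - ((a t)^T *m Ra (x t) *m a t) 0 0)%:E)%E.

Definition payoff (F : 'cV[R]_n -> 'cV[R]_mu -> 'cV[R]_ma -> 'cV[R]_n)
    (J : (R -> 'cV[R]_n) -> (R -> 'cV[R]_mu) -> (R -> 'cV[R]_ma) -> \bar R)
    (x0 : 'cV[R]_n)
    (u : 'cV[R]_n -> 'cV[R]_mu) (a : 'cV[R]_n -> 'cV[R]_ma) : \bar R :=
  let x := the_solution (closed_loop F u a) x0 in J x (u \o x) (a \o x).

Definition saddle_control (V : 'cV[R]_n -> R) (Lu : 'cV[R]_n -> 'rV[R]_mu)
    (Ru : 'cV[R]_n -> 'M[R]_mu) {N : nat}
    (G : 'cV[R]_n -> 'cV[R]_N -> 'M[R]_(n, mu))
    (x : 'cV[R]_n) (thetac : 'cV[R]_N) : 'cV[R]_mu :=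
  - 2^-1 *: (invmx (Ru x) *m (Lu x + gradient V x *m G x thetac)^T).

Definition saddle_adversary (V : 'cV[R]_n -> R) (La : 'cV[R]_n -> 'rV[R]_ma)
    (Ra : 'cV[R]_n -> 'M[R]_ma) {N : nat}
    (K : 'cV[R]_n -> 'cV[R]_N -> 'M[R]_(n, ma))
    (x : 'cV[R]_n) (thetaa : 'cV[R]_N) : 'cV[R]_ma :=
  2^-1 *: (invmx (Ra x) *m (La x + gradient V x *m K x thetaa)^T).

End differential_game.

Section min_max.
Context {R : realType} {A B : Type}.

Definition is_max (E : set (\bar R)) (v : \bar R) : Prop := E v /\ ubound E v.

Definition is_min (E : set (\bar R)) (v : \bar R) : Prop := E v /\ lbound E v.

(* v = min_u max_a J(u, a): the outer minimum is attained, at a point where the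
   inner maximum is attained; elsewhere the inner one may be a supremum. *)
Definition is_min_max (U : set A) (W : set B) (J : A -> B -> \bar R)
    (v : \bar R) : Prop :=
  (exists2 u, U u & is_max [set J u a | a in W] v) /\
  (forall u, U u -> (v <= ereal_sup [set J u a | a in W])%E).

Definition is_max_min (U : set A) (W : set B) (J : A -> B -> \bar R)
    (v : \bar R) : Prop :=
  (exists2 a, W a & is_min [set J u a | u in U] v) /\
  (forall a, W a -> (ereal_inf [set J u a | u in U] <= v)%E).

End min_max.

(* Main.v *)
(* Along a trajectory in S, V(x(t)) is absolutely continuous with derivative
   V'(x)(f + G u + K a). Completing the squares turns the running cost into minus
   this derivative, plus the R_u-square of u - u* and minus the R_a-square of
   a - a*. As x vanishes at Tp, the cost is V(x0) plus the deviation term of u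
   minus that of a, which gives the saddle point and the value.

   In the closed loop, V decreases along trajectories and its sublevel sets are
   compact, so that local solutions stay in S and extend to all times. Moreover
   V decreases at least at the rate (gamma / Tp) (alpha V^p + beta V^q)^r, and
   the integral of dv / (alpha v^p + beta v^q)^r over the half-line is a beta
   integral with value gamma, so that V vanishes from Tp on. *)

Require Import Defs.
From mathcomp Require Import all_boot all_order all_algebra.
From mathcomp Require Import all_classical all_reals all_analysis.
From mathcomp Require Import measurable_realfun ring lra.
Import Order.TTheory GRing.Theory Num.Theory.
Import numFieldNormedType.Exports.
Local Open Scope classical_set_scope.
Local Open Scope ring_scope.
Set Implicit Arguments.
Unset Strict Implicit.
Unset Printing Implicit Defensive.

(** * The completed Lebesgue measure *)

(** Feedback laws are merely measurable, so a trajectory is only absolutely continuous and its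
    equation holds only almost everywhere. The dynamics is therefore handled in integrated form: the
    chain rule for [V] along a curve is an identity between integrals, with linearization errors
    measured by arc length.

    For the closed loop only local solvability and uniqueness are given. At a finite end time the
    field is bounded along the trajectory, so the trajectory has a limit in its sublevel set, and a
    local solution starting there can be appended.

    A primitive [Q] of the inverse decay rate is controlled only at positive arguments, where it
    lies between 0 and the gain. Vanishing at [T >= Tp] is thus proved by contradiction: if [x T]
    were nonzero, [V] would be positive on all of [[0, T]] and [Q (V (x T)) <= 0] would follow,
    although [Q] is nonnegative and strictly increasing.

    A deviating player may make the cost infinite, so the two bounds on the cost compare measurable
    integrands without any integrability of the deviation terms. *)

Section completed_measure.
Context {R : realType}.
Local Notation Lam := (@completed_lebesgue_measure R).
Local Notation leb := (@lebesgue_measure R).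

Lemma measurable_line (A : set R) :
  measurable A -> measurable (A : set (@lebesgue_line R)).
Proof. exact: sub_caratheodory. Qed.

Lemma measurable_fun_line d (T : measurableType d) (D : set R) (f : R -> T) :
  measurable_fun D f -> measurable D ->
  measurable_fun (D : set (@lebesgue_line R)) (f : @lebesgue_line R -> T).
Proof.
by move=> mf mD _ Y mY; apply: measurable_line; exact: mf.
Qed.

Lemma measurable_id_line : measurable_fun [set: @lebesgue_line R]
  (id : @lebesgue_line R -> measurableTypeR R).
Proof. by move=> _ Y mY; rewrite setTI; exact: measurable_line. Qed.

Lemma completed_measureE (A : set R) : Lam A = leb A.
Proof. by []. Qed.

(** The identity map from the Lebesgue to the Borel sigma-algebra pushes [Lam] forward to [leb].
    Change of variables along it gives the nonnegative case; positive and negative parts give the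
    rest. *)
Lemma integral_line (D : set R) (f : R -> \bar R) :
  measurable D -> measurable_fun D f ->
  (\int[Lam]_(x in D) f x = \int[leb]_(x in D) f x)%E.
Proof.
move=> mD mf.
have H (g : R -> \bar R) : measurable_fun D g -> (forall x, 0 <= g x)%E ->
   (\int[Lam]_(x in D) g x = \int[leb]_(x in D) g x)%E.
  move=> mg g0.
  have push := @ge0_integral_pushforward _ _ _ (measurableTypeR R) R _
    measurable_id_line Lam D g mD mg (fun x _ => g0 x).
  apply: (etrans (esym push)).
  apply: eq_measure_integral; first exact: measurable_id_line.
  by move=> mid A _ _.
rewrite [LHS]integralE [RHS]integralE; congr (_ - _)%E; apply: H => //.
  exact: measurable_funepos.
exact: measurable_funeneg.
Qed.

Lemma integrable_line (D : set R) (f : R -> \bar R) :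
  measurable D -> leb.-integrable D f -> Lam.-integrable D f.
Proof.
move=> mD /integrableP[mf fi]; apply/integrableP; split.
  exact: measurable_fun_line.
by rewrite integral_line//; apply: measurableT_comp.
Qed.

Lemma Rintegral_line (D : set R) (f : R -> R) :
  measurable D -> measurable_fun D f ->
  \int[Lam]_(x in D) f x = \int[leb]_(x in D) f x.
Proof.
by move=> mD mf; rewrite /Rintegral integral_line//; apply/measurable_EFinP.
Qed.

Lemma completed_itvcc (a b : R) : a <= b -> Lam `[a, b] = (b - a)%:E.
Proof.
move=> ab; rewrite completed_measureE lebesgue_measure_itv/=.
rewrite lte_fin; case: ltP => // ba.
by rewrite (@le_anti _ _ a b) ?ab ?ba// subrr.
Qed.

Lemma completed_itvoc (a b : R) : a <= b -> Lam `]a, b] = (b - a)%:E.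
Proof.
move=> ab; rewrite completed_measureE lebesgue_measure_itv/=.
rewrite lte_fin; case: ltP => // ba.
by rewrite (@le_anti _ _ a b) ?ab ?ba// subrr.
Qed.

Lemma Rintegral_segB (f : R -> R) (t s : R) : 0 <= t -> t <= s ->
  Lam.-integrable `[0, s] (EFin \o f) ->
  \int[Lam]_(x in `[0, s]) f x - \int[Lam]_(x in `[0, t]) f x =
  \int[Lam]_(x in `]t, s]) f x.
Proof.
move=> t0 ts fi.
have E : `[0, s]%classic = `[0, t]%classic `|` `]t, s]%classic.
  by rewrite -itv_bndbnd_setU// ?bnd_simp.
rewrite E Rintegral_setU/= -?E//.
- by rewrite addrC addKr.
- exact: measurable_line.
- exact: measurable_line.
- apply/disj_setPS => x [/=]; rewrite !in_itv/= => /andP[_ a] /andP[b _].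
  by move: (lt_le_trans b a); rewrite ltxx.
Qed.

Lemma integrable_seg (f : R -> \bar R) (t s : R) : t <= s ->
  Lam.-integrable `[0, s] f -> Lam.-integrable `[0, t] f.
Proof.
move=> ts; apply: integrableS; try exact: measurable_line.
by apply: subset_itvl; rewrite bnd_simp.
Qed.

Lemma integrable_segoc (f : R -> \bar R) (t s : R) : 0 <= t -> t <= s ->
  Lam.-integrable `[0, s] f -> Lam.-integrable `]t, s] f.
Proof.
move=> t0 ts; apply: integrableS; try exact: measurable_line.
by apply: subset_itvr; rewrite bnd_simp.
Qed.

Lemma Rintegral_seg0 (f : R -> R) : \int[Lam]_(x in `[0, 0]) f x = 0.
Proof.
rewrite /Rintegral (eq_integral (cst (f 0)%:E)); last first.
  by move=> x; rewrite inE/= in_itv/= => /le_anti ->.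
rewrite integral_cst/=; last exact: measurable_line.
by rewrite completed_itvcc// subrr mule0.
Qed.

End completed_measure.

(** * Absolutely continuous curves *)

(** Let [c] be the supremum of the [t] such that [P] holds on all of [[a, t]]. The closedness step
    gives [P c], and if [c < b] the openness step would move the supremum past [c]. *)
Lemma real_induction (R : realType) (P : R -> Prop) (a b : R) : a <= b ->
  P a ->
  (forall t, a <= t < b -> (forall s, a <= s <= t -> P s) ->
     exists2 d, 0 < d & forall s, t <= s <= b -> s < t + d -> P s) ->
  (forall t, a < t <= b -> (forall s, a <= s < t -> P s) -> P t) ->
  forall t, a <= t <= b -> P t.
Proof.
move=> ab Pa Popen Pclosed.
pose A := [set t | a <= t <= b /\ forall s, a <= s <= t -> P s].
have Aa : A a by split; [rewrite lexx|move=> s /le_anti <-].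
have supA : has_sup A by split; [exists a|exists b => t [/andP[]]].
have ubA : has_ubound A by case: supA.
pose c := sup A.
have ac : a <= c by exact: ub_le_sup.
have cb : c <= b by apply: ge_sup; [exists a|move=> t [/andP[]]].
have belowc s : a <= s < c -> P s.
  move=> /andP[as_ sc].
  have cs0 : 0 < c - s by rewrite subr_gt0.
  have [t [tT Pt]] := sup_adherent cs0 supA.
  by rewrite opprB addrC subrK => st; apply: Pt; rewrite as_ ltW.
have Pc : P c.
  move: ac; rewrite le_eqVlt => /predU1P[<-//|ac].
  by apply: Pclosed => //; rewrite ac.
have lec s : a <= s <= c -> P s.
  move=> /andP[as_]; rewrite le_eqVlt => /predU1P[->//|sc].
  by apply: belowc; rewrite as_.
have [cltb|bc] := ltP c b; last first.
  by move=> t /andP[at_ tb]; apply: lec; rewrite at_ (le_trans tb).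
have [d d0 dP] := Popen c (introT andP (conj ac cltb)) lec.
pose s := Num.min b (c + d / 2).
have cs : c < s by rewrite lt_min cltb/= ltrDl divr_gt0.
have As : A s.
  split; first by rewrite (le_trans ac (ltW cs)) ge_min lexx.
  move=> r /andP[ar rs]; have [rc|cr] := leP r c; first by apply: lec; rewrite ar.
  apply: dP; first by rewrite (ltW cr) (le_trans rs)// ge_min lexx.
  apply: (le_lt_trans rs); rewrite (@le_lt_trans _ _ (c + d / 2))//.
    by rewrite ge_min lexx orbT.
  by rewrite ltrD2l gtr_pMr// invf_lt1// ltr1n.
by have := ub_le_sup ubA As; rewrite leNgt cs.
Qed.

Section local_to_global.
Context {R : realType}.

(* Replaces differentiation almost everywhere in the chain rule: neither [phi]
   nor [h] needs a derivative. *)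
Lemma local_to_global_le (phi h : R -> R) (a b : R) : a <= b ->
  (forall s t, a <= s -> s <= t -> t <= b -> h s <= h t) ->
  (forall t, a <= t <= b -> exists2 d, 0 < d & forall s, a <= s <= b ->
     `|s - t| < d -> `|phi s - phi t| <= `|h s - h t|) ->
  `|phi b - phi a| <= h b - h a.
Proof.
move=> ab hm loc.
have step s t : a <= s -> s <= t -> t <= b -> `|phi t - phi s| <= `|h t - h s| ->
    `|phi s - phi a| <= h s - h a -> `|phi t - phi a| <= h t - h a.
  move=> as_ st tb; rewrite [leRHS]ger0_norm ?subr_ge0 ?hm// => H1 H2.
  rewrite -(subrKA (phi s) (phi t) (- phi a)).
  rewrite (le_trans (ler_normD _ _))//.
  by rewrite -(subrKA (h s) (h t) (- h a)) lerD.
apply: (real_induction (P := fun t => `|phi t - phi a| <= h t - h a) ab).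
- by rewrite !subrr normr0.
- move=> t /andP[at_ tb] Pt; have tI : a <= t <= b by rewrite at_ ltW.
  have [d d0 dP] := loc t tI; exists d => // s /andP[ts sb] std.
  apply: (step t) => //; last by apply: Pt; rewrite at_ lexx.
  apply: dP; first by rewrite sb (le_trans at_).
  by rewrite ger0_norm ?subr_ge0// ltrBlDl.
- move=> t /andP[at_ tb] Pt; have tI : a <= t <= b by rewrite tb ltW.
  have [d d0 dP] := loc t tI; pose s := Num.max a (t - d / 2).
  have as_ : a <= s by rewrite le_max lexx.
  have st : s < t by rewrite gt_max at_/= ltrBlDr ltrDl divr_gt0.
  apply: (step s) => //; [exact: ltW| |by apply: Pt; rewrite as_].
  rewrite distrC (distrC (h t)); apply: dP.
    by rewrite as_ (le_trans (ltW st)).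
  rewrite distrC ger0_norm ?subr_ge0 ?(ltW st)//.
  rewrite (@le_lt_trans _ _ (d / 2))//.
    by rewrite lerBlDl -lerBlDr le_max lexx orbT.
  by rewrite gtr_pMr// invf_lt1// ltr1n.
- by rewrite ab lexx.
Qed.

Lemma within_continuous_ball n (A : set R) (f : R -> 'cV[R]_n) :
  (forall t, A t -> forall e, 0 < e -> exists2 d, 0 < d &
    forall s, A s -> `|s - t| < d -> `|f s - f t| <= e) ->
  {within A, continuous f}.
Proof.
move=> H; apply/subspace_continuousP => t At.
apply/cvgrPdist_le => e e0; have [d d0 Hd] := H t At e e0.
rewrite near_withinE; near=> s => As; rewrite distrC; apply: Hd => //.
Unshelve. all: end_near. Qed.

End local_to_global.

Section AC.
Context {R : realType} {n : nat}.
Local Notation Lam := (@completed_lebesgue_measure R).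
Variables (x g : R -> 'cV[R]_n) (x0 : 'cV[R]_n) (T : R).
Hypothesis T0 : 0 <= T.
Hypothesis gi : forall i, Lam.-integrable `[0, T] (fun s => (g s i 0)%:E).
Hypothesis xE : forall t : R, 0 <= t <= T -> forall i,
  x t i 0 = x0 i 0 + \int[Lam]_(s in `[0, t]) g s i 0.

(** The l1 norm of the velocity [g]: it dominates each entry, hence bounds the maximum norm, and
    inherits integrability from the entries. *)
Definition arc_speed s := \sum_i `|g s i 0|.
Definition arc_length t := \int[Lam]_(s in `[0, t]) arc_speed s.

Lemma arc_speed_ge0 s : 0 <= arc_speed s.
Proof. exact: sumr_ge0. Qed.

Lemma arc_speed_integrable : Lam.-integrable `[0, T] (EFin \o arc_speed).
Proof.
have -> : EFin \o arc_speed = (fun s => (\sum_i `|g s i 0|%:E)%E).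
  by apply/funext => s /=; rewrite /arc_speed sumEFin.
apply: integrable_sum => [|i _]; first exact: measurable_line.
by have := integrable_norm (gi i).
Qed.

Lemma arc_lengthB (t s : R) : 0 <= t -> t <= s -> s <= T ->
  arc_length s - arc_length t = \int[Lam]_(r in `]t, s]) arc_speed r.
Proof.
move=> t0 ts sT; apply: Rintegral_segB => //.
exact: integrable_seg sT arc_speed_integrable.
Qed.

Lemma arc_length_le (t s : R) : 0 <= t -> t <= s -> s <= T ->
  arc_length t <= arc_length s.
Proof.
move=> t0 ts sT; rewrite -subr_ge0 arc_lengthB//.
by apply: Rintegral_ge0 => r _; exact: arc_speed_ge0.
Qed.

(** Absolute continuity of the integral of [arc_speed], extended by zero outside [[0, T]]; hence [d]
    is uniform in the two times. *)
Lemma arc_length_continuous (e : R) : 0 < e -> exists2 d, 0 < d &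
  forall t s : R, 0 <= t <= T -> 0 <= s <= T -> `|s - t| < d ->
    `|arc_length s - arc_length t| < e.
Proof.
move=> e0.
have := arc_speed_integrable.
move/(integrable_mkcond _ (measurable_line (measurable_itv _))) => Hi.
have H : Lam.-integrable setT (EFin \o (arc_speed \_ `[0, T])).
  by rewrite -restrict_EFin.
have [d [d0 dP]] := integral_normr_continuous H e0.
exists d => //.
have main (t s : R) : 0 <= t -> t <= s -> s <= T -> s - t < d ->
    `|arc_length s - arc_length t| < e.
  move=> t0 ts sT std.
  rewrite arc_lengthB//.
  rewrite ger0_norm; last by apply: Rintegral_ge0 => r _; exact: arc_speed_ge0.
  have -> : \int[Lam]_(r in `]t, s]) arc_speed r =
      \int[Lam]_(r in `]t, s]) `|(arc_speed \_ `[0, T]) r|; last first.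
    apply: dP; first exact: measurable_line.
    by have : (Lam `]t, s] < d%:E)%E by rewrite completed_itvoc.
  apply: eq_Rintegral => r; rewrite inE/= in_itv/= => /andP[tr rs].
  rewrite patchE ifT; last first.
    by rewrite inE/= in_itv/= (le_trans t0 (ltW tr)) (le_trans rs).
  by rewrite ger0_norm// arc_speed_ge0.
move=> t s /andP[t0 tT] /andP[s0 sT]; case: (leP t s) => ts.
  by move=> stH; apply: main => //; rewrite (le_lt_trans (ler_norm _)).
rewrite distrC (distrC (arc_length s)) => stH.
by apply: main => //; [exact: ltW|rewrite (le_lt_trans (ler_norm _))].
Qed.

Lemma curve_increment (t s : R) : 0 <= t -> t <= s -> s <= T -> forall i,
  x s i 0 - x t i 0 = \int[Lam]_(r in `]t, s]) g r i 0.
Proof.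
move=> t0 ts sT i; rewrite !xE ?t0 ?(le_trans ts)//=; last by rewrite (le_trans t0).
rewrite opprD addrACA subrr add0r -Rintegral_segB//.
exact: integrable_seg sT (gi i).
Qed.

(** Each entry of the increment is an integral of an entry of [g], dominated by that of [arc_speed].
    Thus the monotone function [arc_length] controls all displacements of the curve. *)
Lemma curve_dist (t s : R) : 0 <= t <= T -> 0 <= s <= T ->
  `|x s - x t| <= `|arc_length s - arc_length t|.
Proof.
have main (a b : R) : 0 <= a -> a <= b -> b <= T ->
    `|x b - x a| <= `|arc_length b - arc_length a|.
  move=> a0 ab bT; rewrite [leLHS]mx_normrE; apply/bigmax_leP; split => // -[i j] _ /=.
  rewrite !mxE (ord1 j) curve_increment// [leRHS]ger0_norm ?subr_ge0 ?arc_length_le//.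
  rewrite arc_lengthB//.
  have gi' k : Lam.-integrable `]a, b] (EFin \o (fun s => g s k 0)).
    exact: integrable_segoc a0 ab (integrable_seg bT (gi k)).
  have := le_normr_Rintegral (measurable_line (measurable_itv _)) (gi' i).
  move=> /le_trans; apply.
  apply: le_Rintegral.
  - exact: measurable_line.
  - exact: (integrable_norm (gi' i)).
  - exact: integrable_segoc a0 ab (integrable_seg bT arc_speed_integrable).
  - move=> r _; rewrite /arc_speed (bigD1 i)//= lerDl; exact: sumr_ge0.
move=> /andP[t0 tT] /andP[s0 sT]; case: (leP t s) => ts; first exact: main.
by rewrite distrC (distrC (arc_length s)) main// ltW.
Qed.

Lemma curve_continuous : {within `[0, T], continuous x}.
Proof.
apply: within_continuous_ball => t; rewrite /= in_itv/= => tT e e0.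
have [d d0 dP] := arc_length_continuous e0.
exists d => // s; rewrite in_itv/= => sT st.
by rewrite (le_trans (curve_dist tT sT))// ltW// dP.
Qed.

End AC.

Lemma Rintegral_sum d (T : measurableType d) (R : realType)
    (mu : {measure set T -> \bar R}) (D : set T) (I : Type) (s : seq I)
    (h : I -> T -> R) : measurable D ->
  (forall i, mu.-integrable D (EFin \o h i)) ->
  \int[mu]_(x in D) (\sum_(i <- s) h i x) =
  \sum_(i <- s) \int[mu]_(x in D) h i x.
Proof.
move=> mD hi; elim: s => [|i s IH].
  rewrite big_nil; under eq_Rintegral do rewrite big_nil.
  by rewrite Rintegral_cst// mul0r.
rewrite big_cons -IH -RintegralD//; last first.
  have -> : EFin \o (fun t => \sum_(i <- s) h i t) =
      (fun t => (\sum_(i <- s) (h i t)%:E)%E).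
    by apply/funext => t /=; rewrite sumEFin.
  by apply: integrable_sum => // k _; exact: hi.
by apply: eq_Rintegral => t _; rewrite big_cons.
Qed.

(** * Gradients and the chain rule along absolutely continuous curves *)

Section gradient.
Context {R : realType} {n : nat}.

Lemma normr_entry_le m (M : 'M[R]_(n, m)) i j : `|M i j| <= `|M|.
Proof.
rewrite [leRHS]mx_normrE.
exact: (le_bigmax 0 (fun ij : 'I_n * 'I_m => `|M ij.1 ij.2|) (i, j)).
Qed.

Lemma cV_sum_delta (v : 'cV[R]_n) : v = \sum_j v j 0 *: delta_mx j 0.
Proof.
apply/colP => i; rewrite summxE (bigD1 i)//= big1 ?addr0.
  by rewrite !mxE !eqxx mulr1.
by move=> j ji; rewrite !mxE eq_sym (negbTE ji) mulr0.
Qed.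

Lemma diff_gradient (V : 'cV[R]_n -> R) (y v : 'cV[R]_n) :
  differentiable V y -> 'd V y v = (gradient V y *m v) 0 0.
Proof.
move=> dV; rewrite [in LHS](cV_sum_delta v) linear_sum mxE.
apply: eq_bigr => j _; rewrite linearZ mxE /= deriveE//.
by rewrite mulrC.
Qed.

Lemma differentiable_first_order (V : 'cV[R]_n -> R) (y : 'cV[R]_n) (e : R) :
  differentiable V y -> 0 < e -> exists2 d, 0 < d &
  forall z, `|z - y| < d ->
    `|V z - V y - (gradient V y *m (z - y)) 0 0| <= e * `|z - y|.
Proof.
move=> dV e0; have /diff_locally/eqaddoP/(_ e e0) := dV.
move=> /nbhs_ballP[d /= d0 dP]; exists d => // z zd.
have := dP (z - y); rewrite -ball_normE /ball_/= sub0r normrN => /(_ zd).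
by rewrite !fctE subrK opprD addrA diff_gradient.
Qed.

End gradient.

Section chain_rule.
Context {R : realType} {n : nat}.
Local Notation Lam := (@completed_lebesgue_measure R).
Variables (x g : R -> 'cV[R]_n) (x0 : 'cV[R]_n) (T : R).
Hypothesis T0 : 0 <= T.
Hypothesis gi : forall i, Lam.-integrable `[0, T] (fun s => (g s i 0)%:E).
Hypothesis xE : forall t : R, 0 <= t <= T -> forall i,
  x t i 0 = x0 i 0 + \int[Lam]_(s in `[0, t]) g s i 0.

Lemma continuous_on_curve (U : topologicalType) (h : 'cV[R]_n -> U) :
  (forall t : R, 0 <= t <= T -> {for x t, continuous h}) ->
  {within `[0, T], continuous (h \o x)}.
Proof.
move=> ch; apply/subspace_continuousP => t tT.
have xt : x s @[s --> within `[0, T] (nbhs t)] --> x t.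
  by have /subspace_continuousP := curve_continuous gi xE; apply.
by apply: cvg_comp xt (ch t _); move: tT; rewrite /= in_itv.
Qed.

Lemma segment_bounded_measurable (h : R -> R) :
  {within `[0, T], continuous h} ->
  [bounded h t | t in `[0, T]] /\
  measurable_fun (`[0%R, T] : set (@lebesgue_line R))
    (h : @lebesgue_line R -> R).
Proof.
move=> ch; split.
  have /compact_bounded[M [Mr MP]] :=
    continuous_compact ch (@segment_compact R 0 T).
  by exists M; split => // N MN t tT; apply: MP MN _ _; exists t.
apply: measurable_fun_line; last exact: measurable_itv.
exact: subspace_continuous_measurable_fun.
Qed.

(** Along the curve each entry of [k] is continuous on a segment, hence bounded and measurable, and
    such a factor preserves integrability. *)
Lemma integrable_mulmx_curve (k : 'cV[R]_n -> 'rV[R]_n) :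
  (forall t : R, 0 <= t <= T -> {for x t, continuous k}) ->
  Lam.-integrable `[0, T] (fun s => ((k (x s) *m g s) 0 0)%:E).
Proof.
move=> ck.
have -> : (fun s => ((k (x s) *m g s) 0 0)%:E) =
  (fun s => (\sum_j (k (x s) 0 j)%:E * (g s j 0)%:E)%E).
  by apply/funext => s; rewrite mxE -sumEFin.
apply: integrable_sum => [|j _]; first exact: measurable_line.
have [] := @segment_bounded_measurable ((fun y => k y 0 j) \o x).
  apply: continuous_on_curve => t tT.
  apply: (@cvg_comp _ _ _ k (fun M : 'rV[R]_n => M 0 j)) (ck t tT) _.
  exact: coord_continuous.
move=> bk mk; apply: integrableMr => //; first exact: measurable_line.
Qed.

(* Near each time the error of the linearization of [V] is at most [2 * eta]
   times the arc length travelled; [local_to_global_le] sums these errors. *)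
Theorem chain_rule (V : 'cV[R]_n -> R) :
  (forall t : R, 0 <= t <= T -> differentiable V (x t)) ->
  (forall t : R, 0 <= t <= T -> {for x t, continuous (gradient V)}) ->
  V (x T) = V (x 0) + \int[Lam]_(s in `[0, T]) (gradient V (x s) *m g s) 0 0.
Proof.
move=> dV cV.
pose w s := (gradient V (x s) *m g s) 0 0.
have wi : Lam.-integrable `[0, T] (EFin \o w) by exact: integrable_mulmx_curve.
pose phi t := V (x t) - \int[Lam]_(s in `[0, t]) w s.
suff : `|phi T - phi 0| <= 0.
  rewrite normr_le0 subr_eq0 /phi Rintegral_seg0 subr0 => /eqP <-.
  by rewrite subrK.
apply/ler_addgt0Pr => e e0; rewrite add0r.
pose H := arc_length g T.
have H0 : 0 <= H by apply: Rintegral_ge0 => s _; exact: arc_speed_ge0.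
(* The accumulated error will be [2 * eta * H], which is at most [e]; the added 1 covers a curve of
   length zero. *)
pose eta := e / (2 * (H + 1)).
have eta0 : 0 < eta by rewrite divr_gt0// mulr_gt0// ltr_wpDl.
suff : `|phi T - phi 0| <= 2 * eta * arc_length g T - 2 * eta * arc_length g 0.
  move=> /le_trans; apply; rewrite {2}/arc_length Rintegral_seg0 mulr0 subr0.
  have H1 : 0 < H + 1 by rewrite ltr_wpDl.
  have -> : 2 * eta = e / (H + 1) by rewrite /eta; field; rewrite gt_eqF.
  by rewrite mulrAC ler_pdivrMr// ler_pM2l// lerDl.
apply: (@local_to_global_le _ phi (fun t => 2 * eta * arc_length g t)) => //.
  move=> s t s0 st tT; rewrite (ler_pM2l (mulr_gt0 (ltr0n R 2) eta0)).
  exact: (arc_length_le gi).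
move=> t tT.
have [d1 d10 d1P] := differentiable_first_order (dV t tT) eta0.
have /cvgrPdist_le/(_ _ eta0)/nbhs_ballP[d2 /= d20 d2P] := cV t tT.
have d120 : 0 < Num.min d1 d2 by rewrite lt_min d10.
have [d d0 dP] := arc_length_continuous gi d120.
exists d => // s sT std.
have near_x (r : R) : 0 <= r <= T -> `|r - t| < d ->
    `|x r - x t| < d1 /\ `|x r - x t| < d2.
  move=> rT rtd; have := le_lt_trans (curve_dist gi xE tT rT) (dP _ _ tT rT rtd).
  by rewrite lt_min => /andP[].
have [tx1 _] := near_x s sT std.
have part1 := d1P _ tx1.
(* The linear term at [x t] is itself the integral of [gradient V (x t) *m g], so this difference
   integrates [g] against the oscillation of the gradient, which is at most [eta] between the times
   [t] and [s]. *)
have part2 : `|(gradient V (x t) *m (x s - x t)) 0 0 -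
    (\int[Lam]_(r in `[0, s]) w r - \int[Lam]_(r in `[0, t]) w r)| <=
    eta * `|arc_length g s - arc_length g t|.
  have main (a b : R) : 0 <= a -> a <= b -> b <= T ->
     (forall r : R, a < r <= b -> `|r - t| < d) ->
    `|(gradient V (x t) *m (x b - x a)) 0 0 -
    (\int[Lam]_(r in `[0, b]) w r - \int[Lam]_(r in `[0, a]) w r)| <=
    eta * `|arc_length g b - arc_length g a|.
    move=> a0 ab bT rtd.
    have mab := measurable_line (measurable_itv `]a, b]).
    have gi' k : Lam.-integrable `]a, b] (EFin \o (fun s => g s k 0)).
      exact: integrable_segoc a0 ab (integrable_seg bT (gi k)).
    have wi' := integrable_segoc a0 ab (integrable_seg bT wi).
    rewrite Rintegral_segB//; last exact: integrable_seg bT wi.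
    rewrite ger0_norm ?subr_ge0 ?(arc_length_le gi)// (arc_lengthB gi)//.
    have gradi : Lam.-integrable `]a, b] (EFin \o
        (fun r => (gradient V (x t) *m g r) 0 0)).
      have -> : EFin \o (fun r => (gradient V (x t) *m g r) 0 0) =
          (fun r => (\sum_j (gradient V (x t) 0 j)%:E * (g r j 0)%:E)%E).
        by apply/funext => r /=; rewrite mxE -sumEFin.
      by apply: integrable_sum => // j _; exact: integrableZl (gi' j).
    have -> : (gradient V (x t) *m (x b - x a)) 0 0 =
        \int[Lam]_(r in `]a, b]) (gradient V (x t) *m g r) 0 0.
      under [RHS]eq_Rintegral do rewrite mxE.
      rewrite Rintegral_sum//; last by move=> j; exact: integrableZl (gi' j).
      rewrite mxE; apply: eq_bigr => j _.
      rewrite (RintegralZl _ mab (gi' j)).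
      by rewrite !mxE (curve_increment gi xE).
    rewrite -RintegralB//.
    have di := integrableB mab gradi wi'.
    apply: (le_trans (le_normr_Rintegral mab di)).
    have si := integrable_segoc a0 ab (integrable_seg bT (arc_speed_integrable gi)).
    rewrite -RintegralZl//.
    apply: le_Rintegral => //.
    - exact: integrable_norm di.
    - exact: integrableZl si.
    move=> r; rewrite /= in_itv/= => rab.
    rewrite /w -[X in X - _]/((gradient V (x t) *m g r) 0 0).
    have rT : 0 <= r <= T.
      by case/andP: rab => /ltW ar rb; rewrite (le_trans a0)// (le_trans rb).
    have [_ rt2] := near_x r rT (rtd r rab).
    have := d2P (x r); rewrite -ball_normE /ball_/= distrC => /(_ rt2) Dle.
    have -> : (gradient V (x t) *m g r) 0 0 - (gradient V (x r) *m g r) 0 0 =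
       \sum_j (gradient V (x t) - gradient V (x r)) 0 j * g r j 0.
      by rewrite !mxE -sumrB; apply: eq_bigr => j _; rewrite !mxE mulrBl.
    rewrite (le_trans (ler_norm_sum _ _ _))// /arc_speed mulr_sumr.
    apply: ler_sum => j _; rewrite normrM ler_wpM2r//.
    exact: le_trans (normr_entry_le _ _ _) Dle.
  case/andP: sT => s0 sT; case/andP: tT => t0 tT.
  case: (leP t s) => ts.
    apply: main => // r /andP[tr rs]; rewrite ger0_norm ?subr_ge0 ?ltW//.
    by apply: le_lt_trans std; rewrite ger0_norm ?lerD2r// subr_ge0.
  rewrite -(opprB (x t)) mulmxN mxE -normrN opprD opprK opprB.
  rewrite (distrC (arc_length g s)); apply: main => //; first exact: ltW.
  move=> r /andP[sr rt]; apply: le_lt_trans std.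
  rewrite !ler0_norm ?subr_le0 ?(ltW ts)// !opprB.
  by rewrite lerD2l lerN2 ltW.
rewrite -!mulrBr normrM [`|2 * eta|]ger0_norm; last by rewrite mulr_ge0// ltW.
have -> : phi s - phi t =
    (V (x s) - V (x t) - (gradient V (x t) *m (x s - x t)) 0 0) + ((gradient V (x t) *m (x s - x t)) 0 0 -
    (\int[Lam]_(r in `[0, s]) w r - \int[Lam]_(r in `[0, t]) w r)).
  rewrite addrA subrK /phi; ring.
rewrite (le_trans (ler_normD _ _))// -mulrA mulr_natl mulr2n.
apply: lerD part2; apply: (le_trans part1); rewrite ler_pM2l//.
exact: (curve_dist gi xE tT sT).
Qed.
End chain_rule.

(** * Gamma and beta integrals *)

Lemma is_derive_add1 (R : realType) (t : R) : is_derive t 1 (fun s : R => 1 + s) 1.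
Proof.
have := is_deriveD (is_derive_cst (1 : R) t (1 : R)) (is_derive_id t (1 : R)).
by rewrite add0r.
Qed.

Section Gamma.
Context {R : realType}.
Local Notation leb := (@lebesgue_measure R).
Local Notation half_line := (`]0%R, +oo[%classic : set R).
Local Open Scope ereal_scope.

(** The image of Lebesgue measure under multiplication by [c], rescaled by [c], has the right value
    on half-open intervals, so uniqueness identifies it with Lebesgue measure. *)
Lemma ge0_integral_scaling (c : R) (f : R -> \bar R) : (0 < c)%R ->
  measurable_fun [set: R] f -> (forall t, 0 <= f t) ->
  \int[leb]_(t in half_line) f t = c%:E * \int[leb]_(t in half_line) f (c * t)%R.
Proof.
move=> c0 mf f0.
pose phi : measurableTypeR R -> measurableTypeR R := fun t => (c * t)%R.
have mphi : measurable_fun [set: measurableTypeR R] phi.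
  exact: measurable_funM.
pose nu := mscale (NngNum (ltW c0)) (pushforward leb phi).
have lebE (A : set R) : measurable A -> leb A = nu mphi A.
  apply: lebesgue_measure_unique => _ [[a b]] _ <-.
  rewrite /nu /mscale/= /pushforward.
  rewrite [X in _ = _ * leb X](_ : _ = `](a / c)%R, (b / c)%R]%classic); last first.
    apply/seteqP; split => t /=; rewrite !in_itv/= /phi.
      by rewrite ltr_pdivrMr// ler_pdivlMr// !(mulrC c).
    by rewrite ltr_pdivrMr// ler_pdivlMr// !(mulrC c).
  rewrite !lebesgue_measure_itv/= !lte_fin ltr_pM2r ?invr_gt0//.
  case: ltP => _; last by rewrite mule0.
  by rewrite -!EFinB -EFinM -mulrBl mulrCA divff ?mulr1// gt_eqF.
rewrite (eq_measure_integral (nu mphi)); last by move=> A mA _; exact: lebE.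
rewrite ge0_integral_mscale//; last exact: measurable_funTS.
rewrite ge0_integral_pushforward//; last exact: measurable_funTS.
congr (_ * _); rewrite (_ : phi @^-1` _ = half_line)//.
by apply/seteqP; split => t /=; rewrite !in_itv/= !andbT /phi pmulr_rgt0.
Qed.

Definition gamma_density (z t : R) : R := (t `^ (z - 1) * expR (- t))%R.

(** [Gamma] with values in the extended reals, so that scaling and Tonelli can be applied without
    regard to finiteness. *)
Definition eGamma z := \int[leb]_(t in half_line) (gamma_density z t)%:E.

Lemma gamma_density_ge0 z t : (0 <= gamma_density z t)%R.
Proof. by rewrite mulr_ge0 ?powR_ge0 ?expR_ge0. Qed.

Lemma measurable_gamma_density z : measurable_fun [set: R] (gamma_density z).
Proof.
apply: measurable_funM; first exact: measurable_powR.
by apply: measurableT_comp => //; exact: measurable_funN.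
Qed.

(** Evaluates the inner integrals in the two orders of integration of [eGamma_mul], with [c = 1 + s]
    and [c = t]. *)
Lemma eGamma_scaling (z c : R) : (0 < c)%R ->
  \int[leb]_(t in half_line) (t `^ (z - 1) * expR (- (c * t)))%:E =
  (c `^ (- z))%:E * eGamma z.
Proof.
move=> c0; rewrite /eGamma.
rewrite [in RHS](@ge0_integral_scaling c (EFin \o gamma_density z))//; last 2 first.
  by apply/measurable_EFinP; exact: measurable_gamma_density.
  by move=> t; rewrite lee_fin gamma_density_ge0.
rewrite [X in _ = _ * (_ * X)](_ : _ = \int[leb]_(t in half_line)
    ((c `^ (z - 1))%:E * (t `^ (z - 1) * expR (- (c * t)))%:E)); last first.
  apply: eq_integral => t; rewrite inE/= in_itv/= andbT => t0.
  by rewrite /gamma_density powRM ?ltW// -EFinM !mulrA.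
rewrite ge0_integralZl//; last 3 first.
  apply/measurable_EFinP; apply: measurable_funTS; apply: measurable_funM.
    exact: measurable_powR.
  apply: measurableT_comp => //; apply: measurable_funN.
  exact: measurable_funM.
  by move=> t _; rewrite lee_fin mulr_ge0 ?powR_ge0 ?expR_ge0.
  by rewrite lee_fin powR_ge0.
rewrite !muleA -!EFinM [X in _ = X%:E * _](_ : _ = 1%R) ?mul1e//.
rewrite -{2}(powRr1 (ltW c0)) -!powRD ?(gt_eqF c0) ?implybT//.
by rewrite (_ : _ + _ = 0)%R ?powRr0//; ring.
Qed.

(** Raise [1 + t <= (z + 1) * (1 + t / (z + 1)) <= (z + 1) * expR (t / (z + 1))] to the power
    [z + 1]. This exponent is chosen so that the product with [t^(z - 1)] has an explicit
    primitive. *)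
Lemma expRN_le (z t : R) : (0 < z)%R -> (0 < t)%R ->
  (expR (- t) <= (z + 1) `^ (z + 1) * (1 + t) `^ (- (z + 1)))%R.
Proof.
move=> z0 t0.
have m0 : (0 < z + 1)%R by rewrite addr_gt0.
have t1 : (0 < 1 + t)%R by rewrite addr_gt0.
rewrite powRN expRN ler_pdivlMr ?powR_gt0// mulrC ler_pdivrMr ?expR_gt0//.
have -> : (expR t = expR (t / (z + 1)) `^ (z + 1))%R.
  by rewrite -expRM// divfK// gt_eqF.
rewrite -powRM ?expR_ge0 ?(ltW m0)//.
apply: ge0_ler_powR; rewrite ?nnegrE ?(ltW m0) ?(ltW t1)//.
  by rewrite mulr_ge0 ?expR_ge0 ?(ltW m0).
apply: (@le_trans _ _ ((z + 1) * (1 + t / (z + 1))))%R.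
  by rewrite mulrDr mulr1 mulrCA divff ?gt_eqF// mulr1 lerD2r lerDr ltW.
rewrite ler_pM2l//; exact: expR_ge1Dx.
Qed.

(* A bounded primitive: by [expRN_le], its derivative dominates the integrand of
   the Gamma function up to a constant. *)
Lemma is_derive_ratio_powR (z t : R) : (0 < t)%R ->
  is_derive t 1%R (fun s : R => (s / (1 + s)) `^ z)%R
    (z * t `^ (z - 1) * (1 + t) `^ (- (z + 1)))%R.
Proof.
move=> t0.
have t1 : (0 < 1 + t)%R by rewrite addr_gt0.
have dq : is_derive t 1%R (fun s : R => s / (1 + s))%R ((1 + t) ^- 2)%R.
  have D2 := is_deriveV (lt0r_neq0 t1) (is_derive_add1 t).
  have D3 : is_derive t 1%R (fun s : R => s / (1 + s))%R _ :=
    is_deriveM (is_derive_id t (1%R : R)) D2.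
  apply: (is_derive_eq D3).
  rewrite -![_ *: _]/(_ * _)%R /=; field; exact: lt0r_neq0.
have := @is_derive1_comp R (fun y => y `^ z)%R (fun s : R => s / (1 + s))%R t _ _
   (is_derive1_powR z (divr_gt0 t0 t1)) dq.
move=> H; apply: (is_derive_eq H).
rewrite powRM ?invr_ge0 ?ltW//.
have -> : ((1 + t)^-1 `^ (z - 1) = (1 + t) `^ (- (z - 1)))%R.
  by rewrite -powR_inv1 ?ltW// -powRrM mulN1r.
rewrite -powR_invn ?ltW// -!mulrA -powRD ?(gt_eqF t1) ?implybT//.
by congr (_ * (_ * _ `^ _))%R; ring.
Qed.

(** The dominating density has a primitive with values in [[0, 1]], so the integrals over the
    segments [[1 / (n + 1), n + 1]] are bounded uniformly in [n]; monotone convergence concludes. *)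
Lemma eGamma_lty (z : R) : (0 < z)%R -> eGamma z < +oo.
Proof.
move=> z0.
pose F n : set R := `[(n.+1%:R^-1)%R, (n.+1%:R)%R]%classic.
have FU : half_line = \bigcup_n F n.
  apply/seteqP; split => t.
    rewrite /= in_itv/= andbT => t0.
    have [k kP] : exists k : nat, (Num.max t t^-1 <= k.+1%:R)%R.
      exists (Num.bound (Num.max t t^-1)%R).
      rewrite (le_trans (ltW (archi_boundP _)))// ?ler_nat//.
      by rewrite le_max ltW.
    move: kP; rewrite ge_max => /andP[k1 k2]; exists k => //.
    rewrite /F /= in_itv/= k1 andbT -(invrK t) lef_pV2//.
      by rewrite posrE ltr0n.
    by rewrite posrE invr_gt0.
  by move=> [n _]; rewrite /F/= !in_itv/= andbT => /andP[+ _]; apply: lt_le_trans.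
(* The constant of [expRN_le], divided by the factor [z] in the derivative of the primitive. *)
pose C := ((z + 1) `^ (z + 1) / z)%R.
have C0 : (0 <= C)%R by rewrite divr_ge0 ?powR_ge0 ?ltW.
have bound n : \int[leb]_(t in F n) (gamma_density z t)%:E <= C%:E.
  have n0 : (0 < n.+1%:R :> R)%R by rewrite ltr0n.
  have ab : (n.+1%:R^-1 <= n.+1%:R :> R)%R.
    by rewrite (@le_trans _ _ 1%R)// ?invf_le1// ler1n.
  have Fpos (t : R) : F n t -> (0 < t)%R.
    by rewrite /F/= in_itv/= => /andP[+ _]; apply: lt_le_trans; rewrite invr_gt0.
  pose h t : R := (z * t `^ (z - 1) * (1 + t) `^ (- (z + 1)))%R.
  have ch (t : R) : (0 < t)%R -> {for t, continuous h}.
    move=> t0.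
    have t1 : (0 < 1 + t)%R by rewrite addr_gt0.
    apply: (@differentiable_continuous _ _ _ t h).
    apply/derivable1_diffP.
    have D2 := @is_derive1_comp R (fun y => y `^ (- (z + 1)))%R
      (fun s : R => 1 + s)%R t _ _ (is_derive1_powR _ t1) (is_derive_add1 t).
    have D1 := is_deriveM (is_derive_cst (z : R) t (1%R : R))
      (is_derive1_powR (z - 1)%R t0).
    have D3 := is_deriveM D1 D2.
    exact: (@ex_derive _ _ _ _ _ _ _ D3).
  have mF : measurable (F n) by exact: measurable_itv.
  have mh : measurable_fun [set: R] h.
    apply: measurable_funM; last first.
      apply: (measurableT_comp (measurable_powR _)).
      exact: measurable_funD.
    by apply: measurable_funM => //; exact: measurable_powR.
  apply: (@le_trans _ _ (\int[leb]_(t in F n) (C * h t)%:E)).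
    apply: ge0_le_integral => //.
    - by move=> t _; rewrite lee_fin gamma_density_ge0.
    - by apply/measurable_EFinP/measurable_funTS; exact: measurable_gamma_density.
    - by apply/measurable_EFinP/measurable_funTS; exact: measurable_funM.
    - move=> t Ft; have t0 := Fpos t Ft; rewrite lee_fin /gamma_density /C /h.
      rewrite [leRHS](_ : _ = t `^ (z - 1) *
          ((z + 1) `^ (z + 1) * (1 + t) `^ (- (z + 1))))%R.
        by rewrite ler_wpM2l ?powR_ge0// expRN_le.
      by field; exact: lt0r_neq0.
  pose G (s : R) : R := ((s / (1 + s)) `^ z)%R.
  have dG (t : R) : (0 < t)%R -> is_derive t 1%R G (h t) by exact: is_derive_ratio_powR.
  have G01 (t : R) : (0 < t)%R -> (0 <= G t <= 1)%R.
    move=> t0; have t1 : (0 < 1 + t)%R by rewrite addr_gt0.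
    rewrite powR_ge0/= /G -[leRHS](_ : 1 `^ z = 1)%R; last by rewrite powR1.
    apply: ge0_ler_powR.
    - exact: ltW.
    - by rewrite nnegrE divr_ge0// ltW.
    - by rewrite nnegrE.
    - by rewrite ler_pdivrMr// mul1r lerDr.
  rewrite (_ : (fun t => (C * h t)%:E) = (fun t => C%:E * (h t)%:E))//.
  rewrite ge0_integralZl//; last 2 first.
    by apply/measurable_EFinP/measurable_funTS.
    move=> t Ft; rewrite lee_fin; have t0 := Fpos t Ft.
    by rewrite !mulr_ge0 ?powR_ge0// ltW.
  rewrite -[leRHS]mule1; apply: lee_wpmul2l => //.
  (* For [n = 0] the segment is the single point 1, and the fundamental theorem needs distinct
     endpoints. *)
  move: ab; rewrite le_eqVlt => /predU1P[ab|ab].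
    by rewrite /F ab set_itv1 integral_set1 lee01.
  rewrite (@continuous_FTC2 _ h G)//.
  - have /andP[Ga _] := G01 (n.+1%:R^-1)%R (ltac:(by rewrite invr_gt0)).
    have /andP[_ Gb] := G01 (n.+1%:R)%R n0.
    by rewrite -EFinB lee_fin lerBlDr (le_trans Gb)// lerDl.
  - apply/continuous_in_subspaceT => t; rewrite inE => Ft; exact: ch (Fpos t Ft).
  - have cG (t : R) : (0 < t)%R -> {for t, continuous G}.
      move=> t0; apply: (@differentiable_continuous _ _ _ t G).
      by apply/derivable1_diffP; exact: (@ex_derive _ _ _ _ _ _ _ (dG t t0)).
    split.
    + move=> t; rewrite in_itv/= => /andP[t1 _].
      have t0 : (0 < t)%R by apply: lt_trans t1; rewrite invr_gt0.
      exact: (@ex_derive _ _ _ _ _ _ _ (dG t t0)).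
    + by apply: cvg_at_right_filter; apply: cG; rewrite invr_gt0.
    + by apply: cvg_at_left_filter; exact: cG.
  - move=> t; rewrite in_itv/= => /andP[t1 _].
    have t0 : (0 < t)%R by apply: lt_trans t1; rewrite invr_gt0.
    by rewrite derive1E; exact: (@derive_val _ _ _ _ _ _ _ (dG t t0)).
apply: (@le_lt_trans _ _ C%:E); last exact: ltry.
rewrite /eGamma FU.
have FC : (fun n => \int[leb]_(t in F n) (gamma_density z t)%:E) @ \oo -->
    \int[leb]_(t in \bigcup_n F n) (gamma_density z t)%:E.
  apply: ge0_nondecreasing_set_cvg_integral.
  - apply/nondecreasing_seqP => n; rewrite subsetEset; apply: subset_itv.
      by rewrite bnd_simp lef_pV2 ?posrE ?ltr0n// ler_nat.
    by rewrite bnd_simp ler_nat.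
  - by move=> n; exact: measurable_itv.
  - move=> n; apply/measurable_EFinP/measurable_funTS.
    exact: measurable_gamma_density.
  - by move=> n t _; rewrite lee_fin gamma_density_ge0.
rewrite -(cvg_lim _ FC)//; apply: lime_le.
  by apply/cvg_ex; exists (\int[leb]_(t in \bigcup_n F n) (gamma_density z t)%:E).
exact: nearW.
Qed.

Lemma eGamma_gt0 (z : R) : 0 < eGamma z.
Proof.
(* A lower bound of the density on [[1, 2]], where [0 <= ln t <= 2] and [t <= 2]. *)
pose c : R := expR (- (2 * `|z - 1|) - 2)%R.
have : \int[leb]_(t in `[1%R, 2%R]) cst c%:E t <= eGamma z.
  apply: (@le_trans _ _ (\int[leb]_(t in `[1%R, 2%R]) (gamma_density z t)%:E)).
    apply: ge0_le_integral => //.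
    - by move=> t _; rewrite lee_fin expR_ge0.
    - by apply/measurable_EFinP/measurable_funTS; exact: measurable_gamma_density.
    - move=> t; rewrite /= in_itv/= => /andP[t1 t2].
      have t0 : (0 < t)%R by exact: lt_le_trans t1.
      rewrite lee_fin /gamma_density /powR gt_eqF// -expRD ler_expR.
      have lt0 : (0 <= ln t)%R by rewrite ln_ge0.
      have lt2 : (ln t <= 2)%R by rewrite (le_trans (ltW (ln_sublinear t0))).
      apply: lerD; last by rewrite lerN2.
      rewrite lerNl -mulNr (le_trans (ler_norm _))// normrM normrN mulrC.
      by rewrite ler_wpM2r// ger0_norm.
  apply: ge0_subset_integral => //.
  - by apply/measurable_EFinP/measurable_funTS; exact: measurable_gamma_density.
  - by move=> t _; rewrite lee_fin gamma_density_ge0.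
  - by move=> t; rewrite /= !in_itv/= andbT => /andP[+ _]; apply: lt_le_trans.
apply: lt_le_trans.
rewrite integral_cst//= lebesgue_measure_itv/= lte_fin ltr1n/=.
by rewrite -EFinB -EFinM lte_fin mulr_gt0 ?expR_gt0// subr_gt0 ltr1n.
Qed.

Lemma GammaE (z : R) : (0 < z)%R -> (Gamma z)%:E = eGamma z.
Proof.
move=> z0; rewrite /Gamma /Rintegral fineK// ge0_fin_numE ?eGamma_lty//.
by apply: ltW; exact: eGamma_gt0.
Qed.
Lemma Gamma_gt0 (z : R) : (0 < z)%R -> (0 < Gamma z)%R.
Proof. by move=> z0; rewrite -lte_fin GammaE// eGamma_gt0. Qed.

Definition beta_density (a b s : R) : R :=
  (s `^ (a - 1) * (1 + s) `^ (- (a + b)))%R.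

Lemma beta_density_ge0 a b s : (0 <= beta_density a b s)%R.
Proof. by rewrite mulr_ge0 ?powR_ge0. Qed.

Lemma measurable_beta_density a b : measurable_fun [set: R] (beta_density a b).
Proof.
apply: measurable_funM; first exact: measurable_powR.
apply: (measurableT_comp (measurable_powR _)).
exact: measurable_funD.
Qed.

(* Tonelli for [s^(a-1) t^(a+b-1) exp (-(1+s) t)]. *)
Lemma eGamma_mul (a b : R) : (0 < a)%R -> (0 < b)%R ->
  eGamma a * eGamma b =
  eGamma (a + b)%R * \int[leb]_(s in half_line) (beta_density a b s)%:E.
Proof.
move=> a0 b0.
pose u := (fun s : R => (s `^ (a - 1))%R) \_ half_line.
pose v := (gamma_density (a + b)%R) \_ half_line.
pose f (st : measurableTypeR R * measurableTypeR R) :=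
  (u st.1 * v st.2 * expR (- (st.1 * st.2)))%:E.
have mu_ : measurable_fun [set: R] u.
  apply/(measurable_restrictT _ _).1 => //.
  by apply: measurable_funTS; exact: measurable_powR.
have mv : measurable_fun [set: R] v.
  apply/(measurable_restrictT _ _).1 => //.
  by apply: measurable_funTS; exact: measurable_gamma_density.
have mf : measurable_fun setT f.
  apply/measurable_EFinP; apply: measurable_funM.
    apply: measurable_funM.
      exact: (measurableT_comp mu_ measurable_fst).
    exact: (measurableT_comp mv measurable_snd).
  apply: measurableT_comp => //; apply: measurable_funN.
  exact: measurable_funM.
have u0 s : (0 <= u s)%R by rewrite /u patchE; case: ifP => // _; exact: powR_ge0.
have v0 t : (0 <= v t)%R.
  by rewrite /v patchE; case: ifP => // _; exact: gamma_density_ge0.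
have f0 st : 0 <= f st by rewrite lee_fin !mulr_ge0// expR_ge0.
have uE (s : R) : (0 < s)%R -> u s = (s `^ (a - 1))%R.
  by move=> s0; rewrite /u patchE ifT// inE/= in_itv/= s0.
have vE (t : R) : (0 < t)%R -> v t = gamma_density (a + b)%R t.
  by move=> t0; rewrite /v patchE ifT// inE/= in_itv/= t0.
have uN (s : R) : ~ half_line s -> u s = 0%R by move=> s0; rewrite /u patchE memNset.
have vN (s : R) : ~ half_line s -> v s = 0%R by move=> s0; rewrite /v patchE memNset.
have NI (s : R) : s \notin half_line -> ~ half_line s.
  by move=> /negP + ss; apply; rewrite inE.
have := @fubini_tonelli _ _ (measurableTypeR R) (measurableTypeR R) R
  leb leb f mf f0.
(* With [t] innermost, the exponentials combine to [expR (- ((1 + s) * t))], and scaling produces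
   the factor [(1 + s)^(-(a + b))] of the beta density. *)
have -> : \int[leb]_s \int[leb]_t f (s, t) =
    eGamma (a + b)%R * \int[leb]_(s in half_line) (beta_density a b s)%:E.
  transitivity (\int[leb]_(s in half_line)
      (eGamma (a + b)%R * (beta_density a b s)%:E)).
    rewrite [RHS]integral_mkcond; apply: eq_integral => s _; rewrite patchE.
    case: ifPn => [|sN]; last first.
      rewrite (eq_integral (cst 0)) ?integral0// => t _.
      by rewrite /f/= uN ?mul0r//; exact: NI.
    rewrite inE/= in_itv/= andbT => s0.
    have s1 : (0 < 1 + s)%R by rewrite addr_gt0.
    transitivity (\int[leb]_(t in half_line) ((s `^ (a - 1))%:E *
        (t `^ (a + b - 1) * expR (- ((1 + s) * t)))%:E)).
      rewrite [RHS]integral_mkcond; apply: eq_integral => t _; rewrite patchE.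
      case: ifPn => [|tN]; last first.
        by rewrite /f/= vN ?mulr0 ?mul0r//; exact: NI.
      rewrite inE/= in_itv/= andbT => t0.
      rewrite /f/= uE// vE// -EFinM /gamma_density -!mulrA -expRD.
      by congr (_ * (_ * expR _))%:E; ring.
    rewrite ge0_integralZl//; last 3 first.
      apply/measurable_EFinP; apply: measurable_funTS; apply: measurable_funM.
        exact: measurable_powR.
      by apply: measurableT_comp => //; apply: measurable_funN; exact: measurable_funM.
      by move=> t _; rewrite lee_fin mulr_ge0 ?powR_ge0 ?expR_ge0.
      by rewrite lee_fin powR_ge0.
    by rewrite eGamma_scaling// muleA -EFinM muleC.
  rewrite ge0_integralZl//.
  - by apply/measurable_EFinP/measurable_funTS; exact: measurable_beta_density.
  - by move=> s _; rewrite lee_fin beta_density_ge0.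
  - by rewrite ltW// eGamma_gt0.
move=> ->.
(* With [s] innermost, scaling by [t] produces [t^(-a)], which lowers [t^(a + b - 1)] to
   [t^(b - 1)]. *)
transitivity (\int[leb]_(t in half_line) (eGamma a * (gamma_density b t)%:E)).
  rewrite ge0_integralZl//.
  - by apply/measurable_EFinP/measurable_funTS; exact: measurable_gamma_density.
  - by move=> t _; rewrite lee_fin gamma_density_ge0.
  - by rewrite ltW// eGamma_gt0.
rewrite [LHS]integral_mkcond; apply: eq_integral => t _; rewrite patchE.
case: ifPn => [|tN]; last first.
  rewrite (eq_integral (cst 0)) ?integral0// => s _.
  by rewrite /f/= vN ?mulr0 ?mul0r//; exact: NI.
rewrite inE/= in_itv/= andbT => t0.
transitivity (\int[leb]_(s in half_line) ((gamma_density (a + b)%R t)%:E *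
    (s `^ (a - 1) * expR (- (t * s)))%:E)); last first.
  rewrite [LHS]integral_mkcond; apply: eq_integral => s _; rewrite patchE.
  case: ifPn => [|sN]; last first.
    by rewrite /f/= uN ?mul0r//; exact: NI.
  rewrite inE/= in_itv/= andbT => s0.
  by rewrite /f/= uE// vE// -EFinM mulrA (mulrC t) (mulrC (gamma_density _ _)).
rewrite ge0_integralZl//; last 3 first.
  apply/measurable_EFinP; apply: measurable_funTS; apply: measurable_funM.
    exact: measurable_powR.
  by apply: measurableT_comp => //; apply: measurable_funN; exact: measurable_funM.
  by move=> s _; rewrite lee_fin mulr_ge0 ?powR_ge0 ?expR_ge0.
  by rewrite lee_fin gamma_density_ge0.
rewrite eGamma_scaling// muleA -EFinM muleC; congr (_%:E * _).
rewrite /gamma_density [RHS]mulrAC -powRD ?(gt_eqF t0) ?implybT//.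
by congr (_ `^ _ * _)%R; ring.
Qed.

End Gamma.

(** * The settling function: a bounded primitive of the inverse decay rate *)

Section settling_function.
Context {R : realType}.
Local Notation leb := (@lebesgue_measure R).

(** [B] is the incomplete beta integral, and the upper bound is the complete one. The latter is
    finite because, by [eGamma_mul], its product with the positive number [Gamma (a + b)] is
    finite. *)
Lemma beta_primitive (a b : R) : 0 < a -> 0 < b -> exists B : R -> R,
  forall s : R, 0 < s -> is_derive s 1 B (beta_density a b s) /\
    0 <= B s <= Gamma a * Gamma b / Gamma (a + b).
Proof.
move=> a0 b0; have ab0 : 0 < a + b by rewrite addr_gt0.
pose I := (\int[leb]_(s in `]0%R, +oo[) (beta_density a b s)%:E)%E.
have mb (D : set R) : measurable_fun D (EFin \o beta_density a b).
  by apply/measurable_EFinP/measurable_funTS; exact: measurable_beta_density.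
have I0 : (0 <= I)%E.
  by apply: integral_ge0 => s _; rewrite lee_fin beta_density_ge0.
have IE : I = (Gamma a * Gamma b / Gamma (a + b))%:E.
  have := eGamma_mul a0 b0; rewrite -/I -!GammaE// => E.
  have Gab := Gamma_gt0 ab0.
  have If : I \is a fin_num.
    rewrite ge0_fin_numE// ltey; apply/negP => /eqP Iy.
    by move: E; rewrite Iy -EFinM gt0_muley// lte_fin.
  move: E; rewrite -(fineK If) -!EFinM => -[->].
  by congr _%:E; field; rewrite gt_eqF.
have le_I (y : R) : (\int[leb]_(s in `]0%R, y]) (beta_density a b s)%:E <= I)%E.
  apply: ge0_subset_integral => //.
  - exact: mb.
  - by move=> s _; rewrite lee_fin beta_density_ge0.
  - by move=> s /=; rewrite !in_itv/= andbT => /andP[].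
have ge_I (y : R) : (0 <= \int[leb]_(s in `]0%R, y]) (beta_density a b s)%:E)%E.
  by apply: integral_ge0 => s _; rewrite lee_fin beta_density_ge0.
have Ify (y : R) :
    (\int[leb]_(s in `]0%R, y]) (beta_density a b s)%:E)%E \is a fin_num.
  by rewrite ge0_fin_numE// (le_lt_trans (le_I y))// IE ltry.
have int_y (y : R) : leb.-integrable `]0, y] (EFin \o beta_density a b).
  apply/integrableP; split; first exact: mb.
  under eq_integral => s _ do rewrite /= ger0_norm ?beta_density_ge0//.
  by rewrite (le_lt_trans (le_I y))// IE ltry.
exists (fun y => \int[leb]_(s in `]0, y]) beta_density a b s) => s s0.
split; last first.
  rewrite -!lee_fin /Rintegral fineK// -IE; apply/andP.
  by split; [exact: ge_I|exact: le_I].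
have cb : {for s, continuous (beta_density a b)}.
  apply: (@differentiable_continuous _ _ _ s (beta_density a b)).
  apply/derivable1_diffP.
  have s1 : 0 < 1 + s by rewrite addr_gt0.
  have D2 := @is_derive1_comp R (fun y => y `^ (- (a + b))) (fun s : R => 1 + s)
    s _ _ (is_derive1_powR _ s1) (is_derive_add1 s).
  have D3 := is_deriveM (is_derive1_powR (a - 1) s0) D2.
  exact: (@ex_derive _ _ _ _ _ _ _ D3).
have s_lt : s < s + 1 by rewrite ltrDl.
have s_gt : (BRight 0 < BRight s)%O by rewrite bnd_simp.
have [] := @continuous_FTC1 R (beta_density a b) (BRight 0) s (s + 1) s_lt
  (int_y _) s_gt cb.
by move=> dB; rewrite derive1E; exact: DeriveDef.
Qed.

Variables (alpha beta p q r : R).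
Hypotheses (alpha0 : 0 < alpha) (beta0 : 0 < beta)
  (r0 : 0 < r) (pr : p * r < 1) (qr : 1 < q * r).

Definition decay_rate (v : R) := (alpha * v `^ p + beta * v `^ q) `^ r.

Let pq : 0 < q - p.
Proof. by rewrite subr_gt0 -(ltr_pM2r r0) (lt_trans pr). Qed.
(** The parameters of the beta integral, with [a + b = r]. As [p < q], the conditions [p * r < 1]
    and [1 < q * r] say exactly that [a] and [b] are positive. *)
Let a := (1 - r * p) / (q - p).
Let b := (r * q - 1) / (q - p).
Let a0 : 0 < a.
Proof. by rewrite divr_gt0// subr_gt0 mulrC. Qed.
Let b0 : 0 < b.
Proof. by rewrite divr_gt0// subr_gt0 mulrC. Qed.
Let abr : a + b = r.
Proof. by rewrite /a /b; field; rewrite gt_eqF. Qed.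

Lemma predefined_time_gain_gt0 : 0 < predefined_time_gain alpha beta p q r.
Proof.
rewrite /predefined_time_gain mulr_gt0 ?powR_gt0 ?divr_gt0//.
- by rewrite mulr_gt0// Gamma_gt0.
- by rewrite !mulr_gt0 ?powR_gt0// Gamma_gt0.
Qed.

Lemma decay_rate_gt0 (v : R) : 0 < v -> 0 < decay_rate v.
Proof. by move=> v0; rewrite powR_gt0// addr_gt0// mulr_gt0// powR_gt0. Qed.

(* The substitution [s = beta / alpha * v^(q - p)] turns a primitive of
   [1 / decay_rate] into an incomplete beta integral. *)
Lemma settling_function : exists Q : R -> R, forall v : R, 0 < v ->
  is_derive v 1 Q (decay_rate v)^-1 /\
  0 <= Q v <= predefined_time_gain alpha beta p q r.
Proof.
have [B HB] := beta_primitive a0 b0.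
(* The factor left over by the substitution; [kappa * Gamma a * Gamma b / Gamma r] is the gain,
   which explains the constant [gamma]. *)
pose kappa := (alpha / beta) `^ a / (alpha `^ r * (q - p)).
have kappa0 : 0 < kappa by rewrite divr_gt0 ?mulr_gt0 ?powR_gt0 ?divr_gt0.
exists (fun v => kappa * B (beta / alpha * v `^ (q - p))) => v v0.
have ba : 0 < beta / alpha by rewrite divr_gt0.
have s0 : 0 < beta / alpha * v `^ (q - p) by rewrite mulr_gt0// powR_gt0.
have [dB /andP[B0 B1]] := HB _ s0; split; last first.
  rewrite mulr_ge0 ?(ltW kappa0)//=.
  apply: (@le_trans _ _ (kappa * (Gamma a * Gamma b / Gamma (a + b)))).
    by rewrite ler_pM2l.
  rewrite abr /predefined_time_gain -/a -/b /kappa.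
  have ratio (A1 A2 A3 A4 A5 A6 : R) :
      A1 / (A4 * A5) * (A2 * A3 / A6) = A2 * A3 / (A4 * A6 * A5) * A1.
    by rewrite !invfM; ring.
  by rewrite ratio.
have d1 := is_deriveM (is_derive_cst (beta / alpha) v (1 : R))
  (is_derive1_powR (q - p) v0).
have d2 := @is_derive1_comp R B (fun v => beta / alpha * v `^ (q - p)) v _ _
  dB d1.
have d3 := is_deriveM (is_derive_cst kappa v (1 : R)) d2.
apply: (is_derive_eq d3).
rewrite /= !scaler0 !addr0 -![_ *: _]/(_ * _) /beta_density abr.
set W := alpha * v `^ p + beta * v `^ q.
have W0 : 0 < W by rewrite addr_gt0// mulr_gt0// powR_gt0.
(* Powers become exponentials of logarithms, so that the claim reduces to an identity between
   exponents, linear in the logarithms; it closes by [a * (q - p) = 1 - r * p]. *)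
have pE (x y : R) : 0 < x -> x `^ y = expR (y * ln x).
  by move=> x0; rewrite /powR gt_eqF.
have vqE : v `^ q = v `^ p * v `^ (q - p).
  by rewrite -powRD ?(gt_eqF v0) ?implybT// addrC subrK.
have -> : 1 + beta / alpha * v `^ (q - p) = W / (alpha * v `^ p).
  rewrite /W vqE; field.
  by rewrite !gt_eqF// powR_gt0.
have lnba : ln (alpha / beta) = - ln (beta / alpha).
  by rewrite -lnV ?posrE// invf_div.
have baE : beta / alpha = expR (ln (beta / alpha)) by rewrite lnK// posrE.
have vp0 : 0 < v `^ p by rewrite powR_gt0.
have vqp0 : 0 < v `^ (q - p) by rewrite powR_gt0.
have avp : 0 < alpha * v `^ p by rewrite mulr_gt0.
rewrite /kappa /decay_rate -/W -powRN (pE _ _ s0) (pE W)//.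
rewrite (pE (W / _)) ?divr_gt0// (pE (alpha / beta)) ?divr_gt0// (pE alpha)//.
have -> : ln (beta / alpha * v `^ (q - p)) =
    ln (beta / alpha) + (q - p) * ln v by rewrite lnM ?posrE// ln_powR.
have -> : ln (W / (alpha * v `^ p)) = ln W - (ln alpha + p * ln v).
  by rewrite ln_div ?posrE// lnM ?posrE// ln_powR.
rewrite lnba (pE v)//.
rewrite [X in _ * (_ * (X * _))]baE.
have aE : a * (q - p) = 1 - r * p by rewrite /a divfK// gt_eqF.
set LB := ln _; set LW := ln W; set LA := ln alpha; set LV := ln v.
rewrite invfM -expRN.
rewrite [LHS](_ : _ = expR (a * - LB) * expR (- (r * LA)) *
   (expR ((a - 1) * (LB + (q - p) * LV)) * expR (- r * (LW - (LA + p * LV)))) *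
   (expR LB * expR ((q - p - 1) * LV))); last by field; rewrite gt_eqF.
rewrite -!expRD; congr expR.
rewrite [LHS](_ : _ = - r * LW + (a * (q - p) - (1 - r * p)) * LV); last ring.
by rewrite aE subrr mul0r addr0.
Qed.

End settling_function.

(** * Continuity of matrix functions *)

Section matrix_continuity.
Context {R : realType} {T : topologicalType} (y : T).

Lemma continuous_mxP m n (M : T -> 'M[R]_(m, n)) :
  {for y, continuous M} <-> forall i j, {for y, continuous (fun z => M z i j)}.
Proof.
split=> [cM i j|cM].
  by apply: (@cvg_comp _ _ _ M (fun N : 'M[R]_(m, n) => N i j) _ (nbhs (M y))) => //;
    exact: coord_continuous.
apply/cvgrPdist_le => e e0.
have : \forall z \near y, forall ij : 'I_m * 'I_n,
    `|M y ij.1 ij.2 - M z ij.1 ij.2| <= e.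
  by apply: filter_forall => -[i j] /=; have /cvgrPdist_le := cM i j; apply.
apply: filterS => z Hz; rewrite [leLHS]mx_normrE.
apply/bigmax_leP; split=> [|ij _]; first exact: ltW.
by rewrite !mxE.
Qed.

Lemma near_eq_continuous_at (U : topologicalType) (f g : T -> U) :
  (\forall z \near y, f z = g z) ->
  {for y, continuous f} -> {for y, continuous g}.
Proof.
move=> fg cf; rewrite /prop_for /continuous_at -(nbhs_singleton fg).
exact: cvg_trans (near_eq_cvg fg) cf.
Qed.

Lemma continuous_sum_at (I : Type) (s : seq I) (P : pred I) (f : I -> T -> R) :
  (forall i, P i -> {for y, continuous (f i)}) ->
  {for y, continuous (fun z => \sum_(i <- s | P i) f i z)}.
Proof.
move=> cf; elim: s => [|i s IH].
  by rewrite /prop_for; under eq_fun do rewrite big_nil; exact: cvg_cst.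
rewrite /prop_for; under eq_fun do rewrite big_cons; case: (boolP (P i)) => // Pi.
exact: (cvgD (cf i Pi) IH).
Qed.

Lemma continuous_prod_at (I : Type) (s : seq I) (P : pred I) (f : I -> T -> R) :
  (forall i, P i -> {for y, continuous (f i)}) ->
  {for y, continuous (fun z => \prod_(i <- s | P i) f i z)}.
Proof.
move=> cf; elim: s => [|i s IH].
  by rewrite /prop_for; under eq_fun do rewrite big_nil; exact: cvg_cst.
rewrite /prop_for; under eq_fun do rewrite big_cons; case: (boolP (P i)) => // Pi.
exact: (cvgM (cf i Pi) IH).
Qed.

Lemma continuous_scalemx_at m n (k : T -> R) (M : T -> 'M[R]_(m, n)) :
  {for y, continuous k} -> {for y, continuous M} ->
  {for y, continuous (fun z => k z *: M z)}.
Proof. by move=> ck cM; exact: (cvgZ ck cM). Qed.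

Lemma continuous_cst_at (U : topologicalType) (c : U) :
  {for y, continuous (fun=> c)}.
Proof. exact: cvg_cst. Qed.

Lemma continuous_addmx_at m n (M N : T -> 'M[R]_(m, n)) :
  {for y, continuous M} -> {for y, continuous N} ->
  {for y, continuous (fun z => M z + N z)}.
Proof. by move=> cM cN; exact: (cvgD cM cN). Qed.

Lemma continuous_mulmx_at m n k (M : T -> 'M[R]_(m, n)) (N : T -> 'M[R]_(n, k)) :
  {for y, continuous M} -> {for y, continuous N} ->
  {for y, continuous (fun z => M z *m N z)}.
Proof.
move=> /continuous_mxP cM /continuous_mxP cN; apply/continuous_mxP => i j.
rewrite /prop_for; under eq_fun do rewrite mxE; apply: continuous_sum_at => l _.
exact: (cvgM (cM i l) (cN l j)).
Qed.

Lemma continuous_trmx_at m n (M : T -> 'M[R]_(m, n)) :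
  {for y, continuous M} -> {for y, continuous (fun z => (M z)^T)}.
Proof.
move=> /continuous_mxP cM; apply/continuous_mxP => i j.
by rewrite /prop_for; under eq_fun do rewrite mxE; exact: cM.
Qed.

Lemma continuous_det_at n (M : T -> 'M[R]_n) :
  {for y, continuous M} -> {for y, continuous (fun z => \det (M z))}.
Proof.
move=> /continuous_mxP cM; rewrite /determinant.
apply: continuous_sum_at => s _; apply: cvgM; first exact: cvg_cst.
by apply: continuous_prod_at => i _; exact: cM.
Qed.

(** The determinant stays nonzero near [y], where the inverse is the adjugate divided by the
    determinant, and both are polynomial in the entries. *)
Lemma continuous_invmx_at n (M : T -> 'M[R]_n) : M y \in unitmx ->
  {for y, continuous M} -> {for y, continuous (fun z => invmx (M z))}.
Proof.
rewrite unitmxE unitfE => My cM.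
have cdet := continuous_det_at cM.
have near_unit : \forall z \near y, \det (M z) != 0.
  exact: (cvgr_neq0 _ cdet).
apply: (near_eq_continuous_at (f := fun z => (\det (M z))^-1 *: \adj (M z))).
  by apply: filterS near_unit => z Mz; rewrite /invmx unitmxE unitfE Mz.
apply: cvgZ; first exact: cvgV.
apply/continuous_mxP => i j; rewrite /prop_for; under eq_fun do rewrite mxE /cofactor.
apply: cvgM; first exact: cvg_cst.
apply: continuous_det_at; apply/continuous_mxP => k l.
rewrite /prop_for; under eq_fun do rewrite !mxE.
by move/continuous_mxP : cM; apply.
Qed.

End matrix_continuity.

Section posdef.
Context {R : realType}.

Lemma posdef_unitmx m (M : 'M[R]_m) : symmetric_posdef M -> M \in unitmx.
Proof.
move=> [_ pM]; rewrite unitmxE unitfE; apply/negP => /det0P[v v0 vM].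
have := pM v^T; rewrite trmx_eq0 v0 trmxK => /(_ isT).
by rewrite vM mul0mx mxE ltxx.
Qed.

Lemma posdef_ge0 m (M : 'M[R]_m) (v : 'cV[R]_m) : symmetric_posdef M ->
  0 <= (v^T *m M *m v) 0 0.
Proof.
move=> [_ pM]; have [->|v0] := eqVneq v 0; first by rewrite mulmx0 mxE.
exact: ltW (pM v v0).
Qed.

End posdef.

Section cV_compactness.
Context {R : realType} {n : nat}.

(** Transposition is continuous and preserves the norm, so compactness carries over from row
    vectors. *)
Lemma bounded_closed_compact_cV (A : set 'cV[R]_n) :
  bounded_set A -> closed A -> compact A.
Proof.
move=> bA cA.
have tr_cont m k : continuous (@trmx R m k).
  by move=> M; apply: continuous_trmx_at => //; exact: cvg_id.
have norm_tr (v : 'rV[R]_n) : `|v^T| = `|v|.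
  have le_tr m k (N : 'M[R]_(m, k)) : `|N^T| <= `|N|.
    rewrite [leLHS]mx_normrE; apply/bigmax_leP; split=> [|ij _] //.
    by rewrite mxE; exact: normr_entry_le.
  by apply/le_anti; rewrite le_tr -{1}(trmxK v) le_tr.
have -> : A = trmx @` (trmx @^-1` A : set 'rV[R]_n).
  apply/seteqP; split=> [v Av|_ [v /= Av <-]//].
  by exists v^T => /=; rewrite trmxK.
apply: continuous_compact; first by apply: continuous_subspaceT; exact: tr_cont.
apply: bounded_closed_compact.
  case: bA => N [Nr NP]; exists N; split=> // e Ne v /= Av.
  by rewrite -norm_tr; exact: (NP e Ne _ Av).
by apply: closed_comp => // v _; exact: tr_cont.
Qed.

End cV_compactness.

(** * Solutions of the closed loop *)

Section sublevel.
Context {R : realType} {n : nat}.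
Variables (S : set 'cV[R]_n) (V : 'cV[R]_n -> R).
Hypothesis BU : blows_up_at_boundary S V.

(** Openness turns continuity within [S] into continuity at every point of [S], and lets a
    trajectory remain in [S] for a short time. *)
Lemma blows_up_open : open S.
Proof.
rewrite openE => z Sz; apply: contrapT => nSz.
have /BU/cvgryPgt/(_ (V z)) : boundary S z by split => //; exact: subset_closure.
by rewrite near_withinE => /nbhs_singleton/(_ Sz); rewrite ltxx.
Qed.

Definition sublevel (c : R) := [set y | S y /\ V y <= c].

(** A limit point outside [S] would lie on the boundary of [S], near which [V] exceeds [c]; a limit
    point in [S] is handled by continuity. *)
Lemma sublevel_closed c : (forall y, S y -> {for y, continuous V}) ->
  closed (sublevel c).
Proof.
move=> cV y Ky.
have [Sy|nSy] := pselect (S y).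
  split => //; rewrite leNgt; apply/negP => cy.
  have nb : \forall z \near y, c < V z by exact: (cvgr_gt _ (cV y Sy)).
  by have [z [[_]]] := Ky _ nb; rewrite /= leNgt => /negP.
have By : boundary S y.
  split; last by move=> /interior_subset.
  by apply: closureS Ky => z [].
have /cvgryPgt/(_ c) := BU By; rewrite near_withinE => nb.
by have [z [[Sz]]] := Ky _ nb; rewrite leNgt => /negP cz /(_ Sz).
Qed.

Lemma sublevel_bounded c : bounded_set S \/ coercive S V ->
  bounded_set (sublevel c).
Proof.
case=> [[M [Mr MP]]|coer]; first by exists M; split=> // N MN y [Sy _]; exact: (MP N).
apply: contrapT => nb.
have far (k : nat) : exists y, sublevel c y /\ k%:R < `|y|.
  apply: contrapT => nk; apply: nb; exists k%:R; split; first exact: realn.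
  move=> N kN y Ky; rewrite /= leNgt; apply/negP => Ny; apply: nk.
  by exists y; split => //; exact: lt_trans Ny.
have [x xP] := choice far.
have : V (x k) @[k --> \oo] --> +oo.
  apply: coer; first by move=> k; case: (xP k) => -[].
  apply/cvgryPge => A; exists (Num.bound A) => // k /= Ak.
  have [A0|A0] := leP 0 A; last by rewrite (le_trans (ltW A0)).
  apply: ltW; apply: lt_trans (proj2 (xP k)).
  by apply: (lt_le_trans (archi_boundP A0)); rewrite ler_nat.
move=> /cvgryPgt/(_ c) [m _ /(_ m (leqnn m))] /=.
by case: (xP m) => -[_]; rewrite leNgt => /negP.
Qed.

End sublevel.

Section solutions.
Context {R : realType} {n : nat}.
Local Notation Lam := (@completed_lebesgue_measure R).
Variable Phi : 'cV[R]_n -> 'cV[R]_n.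

Lemma solution_eq x0 (tau : \bar R) (x y : R -> 'cV[R]_n) :
  solution_on Phi x0 tau x ->
  (forall t : R, 0 <= t -> (t%:E < tau)%E -> x t = y t) ->
  solution_on Phi x0 tau y.
Proof.
move=> sx xy t t0 tt i; have [xi xE] := sx t t0 tt i.
have E s : s \in `[0, t]%classic -> x s = y s.
  rewrite inE/= in_itv/= => /andP[s0 st]; apply: xy => //.
  by rewrite (le_lt_trans _ tt)// lee_fin.
split.
  by apply: eq_integrable xi => [|s sI]; [exact: measurable_line|rewrite E].
rewrite -xy// xE; congr (_ + _); apply: eq_Rintegral => s sI.
by rewrite E.
Qed.

Lemma solution_restrict x0 (tau tau' : \bar R) (x : R -> 'cV[R]_n) :
  (tau' <= tau)%E -> solution_on Phi x0 tau x -> solution_on Phi x0 tau' x.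
Proof. by move=> le sx t t0 tt; apply: sx => //; exact: lt_le_trans le. Qed.

Lemma solution0 x0 (tau : \bar R) (x : R -> 'cV[R]_n) :
  (0 < tau)%E -> solution_on Phi x0 tau x -> x 0 = x0.
Proof.
move=> tau0 sx; apply/matrixP => i j; rewrite (ord1 j).
by have [_ ->] := sx 0 (lexx _) tau0 i; rewrite Rintegral_seg0 addr0.
Qed.

(** For each [T] choose a solution [F T] that lives beyond [T]. By uniqueness [F T] and [F t] agree
    at [t <= T], so the diagonal [t |-> F t t] is a solution. *)
Lemma solution_glue x0 (tau : \bar R) : uniquely_solvable Phi x0 ->
  (forall T : R, 0 <= T -> (T%:E < tau)%E ->
     exists (sigma : R) (y : R -> 'cV[R]_n),
       T < sigma /\ solution_on Phi x0 sigma%:E y) ->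
  exists x, solution_on Phi x0 tau x.
Proof.
move=> uniq ex.
have ex' (T : R) : exists y : R -> 'cV[R]_n, 0 <= T -> (T%:E < tau)%E ->
    exists2 sigma : R, T < sigma & solution_on Phi x0 sigma%:E y.
  have [T0|] := pselect (0 <= T); last by exists (fun=> 0).
  have [Tt|] := pselect (T%:E < tau)%E; last by exists (fun=> 0).
  by have [sigma [y [Ts sy]]] := ex T T0 Tt; exists y => _ _; exists sigma.
have [F FP] := choice ex'.
exists (fun t => F t t) => T T0 Tt.
have [sigma Ts sF] := FP T T0 Tt.
have agree t : 0 <= t <= T -> F T t = F t t.
  move=> /andP[t0 tT].
  have tt : (t%:E < tau)%E by rewrite (le_lt_trans _ Tt)// lee_fin.
  have [sigma' ts' sF'] := FP t t0 tt.
  apply: (uniq (Num.min sigma sigma')).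
  - by apply: solution_restrict sF; rewrite lee_fin ge_min lexx.
  - by apply: solution_restrict sF'; rewrite lee_fin ge_min lexx orbT.
  - by rewrite t0 lt_min ts' (le_lt_trans tT).
(* The diagonal is compared with [F T] only up to [T]; continuing as [F T] makes [y] a solution up
   to [sigma], so that the equation may be read at [T] itself. *)
pose y t := if t <= T then F t t else F T t.
have sy : solution_on Phi x0 sigma%:E y.
  apply: solution_eq sF _ => t t0 _; rewrite /y; case: ifP => // tT.
  by apply: agree; rewrite t0.
move=> i; have [H1] := sy T T0 Ts i.
rewrite /y lexx => ->; split.
  apply: eq_integrable H1; first exact: measurable_line.
  by move=> s; rewrite inE/= in_itv/= => /andP[_ sT]; rewrite /y sT.
congr (_ + _); apply: eq_Rintegral => s.
by rewrite inE/= in_itv/= => /andP[_ ->].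
Qed.

End solutions.

Lemma integrable_setU d (T : measurableType d) (R : realType)
    (mu : {measure set T -> \bar R}) (A B : set T) (f : T -> \bar R) :
  measurable A -> measurable B -> [disjoint A & B] ->
  mu.-integrable A f -> mu.-integrable B f -> mu.-integrable (A `|` B) f.
Proof.
move=> mA mB AB /integrableP[mfA fA] /integrableP[mfB fB].
have mf : measurable_fun (A `|` B) f by apply/measurable_funU.
apply/integrableP; split => //.
rewrite ge0_integral_setU//; first exact: lte_add_pinfty.
exact: measurableT_comp.
Qed.

Section shift.
Context {R : realType}.
Local Notation leb := (@lebesgue_measure R).
Local Notation Lam := (@completed_lebesgue_measure R).

Lemma integral_shift (c : R) (D : set R) (f : R -> \bar R) :
  measurable D -> measurable_fun D f ->
  (\int[leb]_(t in D) f t =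
   \int[leb]_(t in (fun t => (t - c)%R) @^-1` D) f (t - c)%R)%E.
Proof.
move=> mD mf.
pose phi : measurableTypeR R -> measurableTypeR R := fun t => t - c.
have mphi : measurable_fun [set: measurableTypeR R] phi.
  exact: measurable_funB.
have lebE (A : set R) : measurable A -> leb A = pushforward leb phi A.
  move=> mA.
  apply: (@lebesgue_measure_unique R (pushforward leb phi)) => // _ [[a b]] _ <-.
  rewrite /= /pushforward.
  rewrite [X in _ = leb X](_ : _ = `](a + c), (b + c)]%classic); last first.
    by apply/seteqP; split => t /=; rewrite !in_itv/= /phi ltrBrDr lerBlDr.
  rewrite !lebesgue_measure_itv/= !lte_fin ltrD2r.
  by case: ltP => // _; rewrite -!EFinB opprD addrACA subrr addr0.
have H (g : R -> \bar R) : measurable_fun D g -> (forall t, 0 <= g t)%E ->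
    (\int[leb]_(t in D) g t = \int[leb]_(t in phi @^-1` D) g (t - c)%R)%E.
  move=> mg g0.
  have := @ge0_integral_pushforward _ _ _ _ R phi mphi leb D g mD mg (fun t _ => g0 t).
  move=> <-.
  by apply: eq_measure_integral => A mA _; exact: lebE.
rewrite [LHS]integralE [RHS]integralE; congr (_ - _)%E.
  rewrite (H _ (measurable_funepos mf) (funepos_ge0 f)).
  by apply: eq_integral => t _; rewrite !funeposE.
rewrite (H _ (measurable_funeneg mf) (funeneg_ge0 f)).
by apply: eq_integral => t _; rewrite !funenegE.
Qed.

Lemma preimage_shift_itv (a b c : R) :
  (fun t => t - c) @^-1` `[a, b] = `[a + c, b + c]%classic.
Proof.
by apply/seteqP; split => t /=; rewrite !in_itv/= lerBrDr lerBlDr.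
Qed.

(** Continuity makes the integrand Borel on the segment, so both integrals reduce to the Borel
    measure and its translation invariance. *)
Lemma shift_segment (c T : R) (h : R -> R) :
  {within `[0, T], continuous h} ->
  Lam.-integrable `[c, T + c] (fun t => (h (t - c))%:E) /\
  \int[Lam]_(t in `[c, T + c]) h (t - c) = \int[Lam]_(t in `[0, T]) h t.
Proof.
move=> ch.
have mh : measurable_fun `[0, T] h.
  by apply: subspace_continuous_measurable_fun => //; exact: measurable_itv.
have mhc : measurable_fun `[c, T + c] (fun t => h (t - c)).
  rewrite -[X in `[X, _]%classic]add0r -preimage_shift_itv.
  apply: (measurable_comp (F := `[0, T]%classic)) mh _; first exact: measurable_itv.
    by move=> _ [t /= tT <-].
  by apply: measurable_funTS; exact: measurable_funB.
have E (f : R -> \bar R) : measurable_fun `[0, T] f ->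
    (\int[leb]_(t in `[c, (T + c)%R]) f (t - c)%R =
     \int[leb]_(t in `[0%R, T]) f t)%E.
  by move=> mf; rewrite [RHS](@integral_shift c)// preimage_shift_itv add0r.
split.
  apply: integrable_line; first exact: measurable_itv.
  apply/integrableP; split; first exact/measurable_EFinP.
  rewrite (E (fun t => `|h t|%:E))//; last first.
    by apply/measurable_EFinP; exact: measurableT_comp.
  have /continuous_compact_integrable : compact `[0, T] by exact: segment_compact.
  by move=> /(_ h ch) /integrableP[].
rewrite !Rintegral_line//; try exact: measurable_itv.
by congr fine; apply: (E (EFin \o h)); exact/measurable_EFinP.
Qed.

End shift.

(** * Invariance of sublevel sets and continuation to all times *)

Section global_solution.
Context {R : realType} {n : nat}.
Local Notation Lam := (@completed_lebesgue_measure R).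
Variables (S : set 'cV[R]_n) (V : 'cV[R]_n -> R) (Phi : 'cV[R]_n -> 'cV[R]_n).
Hypothesis BU : blows_up_at_boundary S V.
Hypothesis dV : forall y, S y -> differentiable V y.
Hypothesis cV : forall y, S y -> {for y, continuous (gradient V)}.
Hypothesis bV : bounded_set S \/ coercive S V.
Hypothesis cPhi : forall y, S y -> {for y, continuous Phi}.
Hypothesis decay : forall y, S y -> (gradient V y *m Phi y) 0 0 <= 0.

Lemma solution_segment x0 (tau : \bar R) (x : R -> 'cV[R]_n) (T : R) :
  solution_on Phi x0 tau x -> 0 <= T -> (T%:E < tau)%E ->
  (forall i, Lam.-integrable `[0, T] (fun s => ((Phi \o x) s i 0)%:E)) /\
  (forall t : R, 0 <= t <= T -> forall i,
    x t i 0 = x0 i 0 + \int[Lam]_(s in `[0, t]) (Phi \o x) s i 0).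
Proof.
move=> sx T0 Tt; split=> [i|t /andP[t0 tT] i]; first by case: (sx T T0 Tt i).
by have [] := sx t t0 (le_lt_trans (_ : (t%:E <= T%:E)%E) Tt) i; rewrite ?lee_fin.
Qed.

Lemma solution_energy x0 (tau : \bar R) (x : R -> 'cV[R]_n) (T : R) :
  solution_on Phi x0 tau x -> 0 <= T -> (T%:E < tau)%E ->
  (forall t, 0 <= t <= T -> S (x t)) ->
  V (x T) = V x0 + \int[Lam]_(s in `[0, T]) (gradient V (x s) *m Phi (x s)) 0 0.
Proof.
move=> sx T0 Tt Sx; have [gi xE] := solution_segment sx T0 Tt.
have tau0 : (0 < tau)%E by apply: le_lt_trans Tt; rewrite lee_fin.
rewrite -{1}(solution0 tau0 sx).
by apply: (chain_rule T0 gi xE) => t tT; [apply: dV|apply: cV]; exact: Sx.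
Qed.

(** The extended integral of [- h] is nonnegative, and [fine] keeps this sign even at an infinite
    value. *)
Lemma le0_Rintegral_seg (T : R) (h : R -> R) :
  (forall t, 0 <= t <= T -> h t <= 0) ->
  \int[Lam]_(s in `[0, T]) h s <= 0.
Proof.
move=> h0; rewrite /Rintegral.
have -> : (\int[Lam]_(s in `[0%R, T]) (h s)%:E =
    \int[Lam]_(s in `[0%R, T]) (- (- h s)%:E))%E.
  by apply: eq_integral => t _; rewrite EFinN oppeK.
rewrite integral_ge0N; last first.
  by move=> t; rewrite /= in_itv/= => tT; rewrite lee_fin oppr_ge0 h0.
rewrite fineN oppr_le0; apply: fine_ge0; apply: integral_ge0.
by move=> t; rewrite /= in_itv/= => tT; rewrite lee_fin oppr_ge0 h0.
Qed.

(** Real induction on [x t] being in [S]. The open step uses that [S] is open. For the closed step,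
    [V] has not exceeded [V x0] before time [t], so [x t] is a limit of points of a closed sublevel
    set contained in [S]. *)
Lemma solution_stays x0 (tau : \bar R) (x : R -> 'cV[R]_n) : S x0 ->
  solution_on Phi x0 tau x ->
  forall t : R, 0 <= t -> (t%:E < tau)%E -> sublevel S V (V x0) (x t).
Proof.
move=> Sx0 sx T T0 Tt.
have oS := blows_up_open BU.
have [gi xE] := solution_segment sx T0 Tt.
have tau0 : (0 < tau)%E by apply: le_lt_trans Tt; rewrite lee_fin.
have x00 : x 0 = x0 := solution0 tau0 sx.
have below t : 0 <= t <= T -> (forall s, 0 <= s <= t -> S (x s)) ->
    sublevel S V (V x0) (x t).
  move=> /andP[t0 tT] Sx; split; first by apply: Sx; rewrite t0 lexx.
  have tt : (t%:E < tau)%E by rewrite (le_lt_trans _ Tt)// lee_fin.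
  rewrite (solution_energy sx t0 tt Sx) gerDl.
  by apply: le0_Rintegral_seg => s st; apply: decay; exact: Sx.
have cx := curve_continuous gi xE.
have /subspace_continuousP cxP := cx.
suff all : forall t, 0 <= t <= T -> S (x t).
  by apply: below => //; rewrite T0 lexx.
apply: real_induction => //; first by rewrite x00.
- move=> t /andP[t0 tT] Sx.
  have It : `[0, T]%classic t by rewrite /= in_itv/= t0 ltW.
  have : \forall y \near x t, S y.
    by apply: open_nbhs_nbhs; split => //; apply: Sx; rewrite t0 lexx.
  move=> /(cxP t It)/nbhs_ballP[d /= d0 dP].
  exists d => // s /andP[ts sT] std; apply: dP; last first.
    by rewrite /= in_itv/= sT (le_trans t0).
  by rewrite /ball/= distrC ger0_norm ?subr_ge0// ltrBlDl.
- move=> t /andP[t0 tT] Sx.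
  have It : `[0, T]%classic t by rewrite /= in_itv/= tT ltW.
  suff : closure (sublevel S V (V x0)) (x t).
    move/(sublevel_closed BU); case => // y Sy.
    exact: differentiable_continuous (dV Sy).
  move=> B /(cxP t It)/nbhs_ballP[d /= d0 dP].
  pose s := Num.max 0 (t - d / 2).
  have s0 : 0 <= s by rewrite le_max lexx.
  have st : s < t by rewrite gt_max t0/= ltrBlDr ltrDl divr_gt0.
  exists (x s); split.
    apply: below; first by rewrite s0 (le_trans (ltW st)).
    by move=> r /andP[r0 rs]; apply: Sx; rewrite r0 (le_lt_trans rs).
  apply: dP; last by rewrite /= in_itv/= s0 (le_trans (ltW st)).
  rewrite /ball/= ger0_norm ?subr_ge0 ?(ltW st)//.
  rewrite (@le_lt_trans _ _ (d / 2))//.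
    by rewrite lerBlDl -lerBlDr le_max lexx orbT.
  by rewrite gtr_pMr// invf_lt1// ltr1n.
Qed.

Lemma field_bounded c :
  exists M : R, 0 <= M /\ forall y, sublevel S V c y -> `|Phi y| <= M.
Proof.
have cK : compact (sublevel S V c).
  apply: bounded_closed_compact_cV; first exact: sublevel_bounded.
  apply: (sublevel_closed BU) => y Sy; exact: differentiable_continuous (dV Sy).
have cPhiK : {within sublevel S V c, continuous Phi}.
  apply/subspace_continuousP => y [Sy _]; apply: cvg_within_filter; exact: cPhi.
have /compact_bounded[M [Mr MP]] := continuous_compact cPhiK cK.
exists (Num.max 0 M + 1); split; first by rewrite addr_ge0// le_max lexx.
move=> y Ky; apply: (MP (Num.max 0 M + 1)); last by exists y.
by rewrite (@le_lt_trans _ _ (Num.max 0 M)) ?ltrDl// le_max lexx orbT.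
Qed.

Lemma solution_field_continuous x0 (tau : \bar R) (x : R -> 'cV[R]_n) (T : R)
    (i : 'I_n) :
  S x0 -> solution_on Phi x0 tau x -> 0 <= T -> (T%:E < tau)%E ->
  {within `[0, T], continuous (fun t => Phi (x t) i 0)}.
Proof.
move=> Sx0 sx T0 Tt; have [gi xE] := solution_segment sx T0 Tt.
apply: (continuous_on_curve gi xE (h := fun y => Phi y i 0)) => t /andP[t0 tT].
have tt : (t%:E < tau)%E by rewrite (le_lt_trans _ Tt)// lee_fin.
have [Sxt _] := solution_stays Sx0 sx t0 tt.
exact: (@continuous_mxP _ _ _ _ _ _).1 (cPhi Sxt) _ _.
Qed.

(** The value at [c] comes from [y], because nothing is known of [x] at the open end of its
    interval. *)
Definition concatenation (c : R) (x y : R -> 'cV[R]_n) (t : R) :=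
  if t < c then x t else y (t - c).

(** Before [c] the solution stays in a compact sublevel set, where the field is bounded by some [M].
    It therefore converges at [c] to a point of that set, which serves as initial state of a further
    local solution. *)
Lemma solution_extend x0 (c : R) (x : R -> 'cV[R]_n) : 0 < c -> S x0 ->
  solution_on Phi x0 c%:E x ->
  (forall y, S y -> locally_solvable Phi y) ->
  exists (sigma : R) (z : R -> 'cV[R]_n),
    c < sigma /\ solution_on Phi x0 sigma%:E z.
Proof.
move=> c0 Sx0 sx loc.
have [M [M0 MP]] := field_bounded (V x0).
pose h i t := Phi (x t) i 0.
have stay t : 0 <= t -> t < c -> sublevel S V (V x0) (x t).
  by move=> t0 tc; apply: (solution_stays Sx0 sx).
have hM i t : 0 <= t < c -> `|h i t| <= M.
  move=> /andP[t0 tc]; apply: le_trans (MP _ (stay t t0 tc)).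
  exact: normr_entry_le.
have mco : measurable (`[0, c[ : set (@lebesgue_line R)).
  exact: measurable_line (measurable_itv _).
have hi i : Lam.-integrable `[0, c[ (EFin \o h i).
  apply: measurable_bounded_integrable => //.
  - have : (Lam `[0%R, c[ < +oo)%E; last by [].
    by rewrite completed_measureE lebesgue_measure_itv/= lte_fin c0 -EFinB ltry.
  (* Being a solution gives measurability on closed segments only; [[0, c[] is exhausted by the
     segments [[0, c - 1 / (k + 1)]], which may be empty for small [k]. *)
  - rewrite itv_bnd_open_bigcup; apply/measurable_fun_bigcup => k.
      exact: measurable_line (measurable_itv _).
    have [k0|k0] := leP 0 (c - k.+1%:R^-1).
      have [] := sx _ k0 _ i.
        by rewrite lte_fin ltrBlDr ltrDl invr_gt0.
      by move=> /measurable_int /measurable_EFinP.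
    rewrite set_itv_ge; first exact: measurable_fun_set0.
    by rewrite bnd_simp -ltNge.
  - exists M; split; first exact: num_real.
    move=> N MN t; rewrite /= in_itv/= => tc; apply: le_trans (ltW MN).
    exact: hM.
(* The limit of [x] at [c]: with this choice the integral equation of the
   concatenation holds by construction. *)
pose l : 'cV[R]_n := \col_i (x0 i 0 + \int[Lam]_(s in `[0, c[) h i s).
have lx t : 0 <= t -> t < c -> `|l - x t| <= M * (c - t).
  move=> t0 tc.
  have M1 : 0 <= M * (c - t) by rewrite mulr_ge0// subr_ge0 ltW.
  rewrite [leLHS]mx_normrE; apply/bigmax_leP; split => // -[i j] _ /=.
  rewrite !mxE (ord1 j).
  have [_ ->] := sx t t0 tc i.
  have cE : `[0, c[%classic = `[0, t]%classic `|` `]t, c[%classic.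
    by rewrite -itv_bndbnd_setU// bnd_simp.
  have hitc : Lam.-integrable `]t, c[ (EFin \o h i).
    apply: (integrableS _ _ _ (hi i)) => //; first exact: measurable_line (measurable_itv _).
    by apply: subset_itvr; rewrite bnd_simp.
  rewrite cE Rintegral_setU -?cE//; last 3 first.
    exact: measurable_line (measurable_itv _).
    exact: measurable_line (measurable_itv _).
    apply/disj_setPS => s [/=]; rewrite !in_itv/= => /andP[_ a] /andP[b _].
    by move: (lt_le_trans b a); rewrite ltxx.
  rewrite opprD addrACA subrr add0r addrAC subrr add0r.
  apply: (le_trans (le_normr_Rintegral (measurable_line (measurable_itv _)) hitc)).
  have -> : M * (c - t) = \int[Lam]_(s in `]t, c[) M.
    rewrite Rintegral_cst//; last exact: measurable_line (measurable_itv _).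
    have -> : fine (Lam `]t, c[) = c - t; last by [].
    by rewrite completed_measureE lebesgue_measure_itv/= lte_fin tc.
  apply: le_Rintegral.
  - exact: measurable_line (measurable_itv _).
  - exact: integrable_norm hitc.
  - apply: measurable_bounded_integrable => //.
    + exact: measurable_line (measurable_itv _).
    + have : (Lam `]t, c[ < +oo)%E; last by [].
      by rewrite completed_measureE lebesgue_measure_itv/= lte_fin tc -EFinB ltry.
    + by exists M; split => [|N MN s _]; rewrite ?num_real//= ger0_norm// ltW.
  - move=> s; rewrite /= in_itv/= => /andP[ts sc]; apply: hM.
    by rewrite sc (le_trans t0) ?ltW.
have [Sl _] : sublevel S V (V x0) l.
  apply: (sublevel_closed BU) => [y Sy|B].
    exact: differentiable_continuous (dV Sy).
  move=> /nbhs_ballP[d /= d0 dB].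
  (* Close enough to [c] that [M * (c - t) < d]; the added 1 covers [M = 0]. *)
  pose t := Num.max 0 (c - d / (2 * (M + 1))).
  have M1 : 0 < M + 1 by rewrite ltr_wpDl.
  have e0 : 0 < d / (2 * (M + 1)) by rewrite divr_gt0// mulr_gt0.
  have t0 : 0 <= t by rewrite le_max lexx.
  have tc : t < c by rewrite gt_max c0/= ltrBlDr ltrDl.
  exists (x t); split; first exact: stay.
  apply: dB; rewrite -ball_normE /ball_/=.
  apply: (le_lt_trans (lx t t0 tc)).
  apply: (@le_lt_trans _ _ (M * (d / (2 * (M + 1))))).
    by rewrite ler_wpM2l// lerBlDl -lerBlDr le_max lexx orbT.
  rewrite mulrA ltr_pdivrMr ?mulr_gt0// (mulrC M) ltr_pM2l//; lra.
have [sigma [y [sigma0 sy]]] := loc l Sl.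
exists (c + sigma), (concatenation c x y); split; first by rewrite ltrDl.
move=> T T0; rewrite lte_fin => Tcs.
have [Tc|cT] := ltP T c.
  apply: (solution_eq sx) => // t t0; rewrite lte_fin => tc.
  by rewrite /concatenation tc.
move=> i.
have Tc0 : 0 <= T - c by rewrite subr_ge0.
have Tcs' : T - c < sigma by rewrite ltrBlDl.
have cy := solution_field_continuous (i := i) Sl sy Tc0 Tcs'.
have [shi shE] := @shift_segment R c (T - c) _ cy.
rewrite subrK in shi shE.
have mcT : measurable (`[c, T] : set (@lebesgue_line R)).
  exact: measurable_line (measurable_itv _).
have disj : [disjoint (`[0, c[%classic : set R) & `[c, T]%classic].
  apply/disj_setPS => s [/=]; rewrite !in_itv/= => /andP[_ a] /andP[b _].
  by move: (lt_le_trans a b); rewrite ltxx.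
have TE : `[0, T]%classic = `[0, c[%classic `|` `[c, T]%classic.
  by rewrite -itv_bndbnd_setU// bnd_simp ltW.
have i1 : Lam.-integrable `[0, c[ (fun s => (Phi (concatenation c x y s) i 0)%:E).
  apply: eq_integrable (hi i) => // s; rewrite inE/= in_itv/= => /andP[_ sc].
  by rewrite /concatenation sc.
have i2 : Lam.-integrable `[c, T] (fun s => (Phi (concatenation c x y s) i 0)%:E).
  apply: eq_integrable shi => // s; rewrite inE/= in_itv/= => /andP[cs _].
  by rewrite /concatenation ltNge cs.
have iT : Lam.-integrable `[0, T] (fun s => (Phi (concatenation c x y s) i 0)%:E).
  by rewrite TE; exact: integrable_setU.
split => //.
rewrite TE Rintegral_setU -?TE//.
rewrite [X in _ = _ + (X + _)](_ : _ = \int[Lam]_(s in `[0, c[) h i s); last first.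
  apply: eq_Rintegral => s; rewrite inE/= in_itv/= => /andP[_ sc].
  by rewrite /concatenation sc.
rewrite [X in _ = _ + (_ + X)](_ : _ =
    \int[Lam]_(s in `[c, T]) Phi (y (s - c)) i 0); last first.
  apply: eq_Rintegral => s; rewrite inE/= in_itv/= => /andP[cs _].
  by rewrite /concatenation ltNge cs.
rewrite shE /concatenation ltNge cT /=.
have [_ ->] := sy (T - c) Tc0 Tcs' i.
by rewrite mxE addrA.
Qed.

(** If the lengths of the intervals of existence had a finite supremum [c], gluing would give a
    solution up to [c], and [solution_extend] would carry it past [c]. *)
Lemma global_solution x0 : S x0 ->
  (forall y, S y -> locally_solvable Phi y) -> uniquely_solvable Phi x0 ->
  exists x, solution_on Phi x0 +oo%E x.
Proof.
move=> Sx0 loc uniq.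
pose A := [set sigma : R | 0 < sigma /\ exists y, solution_on Phi x0 sigma%:E y].
have [unbounded|bounded] := pselect (forall T : R, exists2 sigma, T < sigma & A sigma).
  apply: solution_glue uniq _ => T T0 _.
  by have [sigma Ts [_ [y sy]]] := unbounded T; exists sigma, y.
have [T TP] : exists T : R, forall sigma, A sigma -> sigma <= T.
  apply: contrapT => nT; apply: bounded => T; apply: contrapT => nA.
  apply: nT; exists T => sigma As; rewrite leNgt; apply/negP => Ts.
  by apply: nA; exists sigma.
have [tau [y [tau0 sy]]] := loc x0 Sx0.
have Atau : A tau by split => //; exists y.
have supA : has_sup A by split; [exists tau|exists T].
have [_ ubA] := supA.
pose c := sup A.
have c0 : 0 < c by apply: (lt_le_trans tau0); exact: ub_le_sup.
have [x sx] : exists x, solution_on Phi x0 c%:E x.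
  apply: solution_glue uniq _ => t t0; rewrite lte_fin => tc.
  have ct0 : 0 < c - t by rewrite subr_gt0.
  have [sigma [_ [z sz]]] := sup_adherent ct0 supA.
  by rewrite opprB addrC subrK => ts; exists sigma, z.
have [sigma [z [cs sz]]] := solution_extend c0 Sx0 sx loc.
have As : A sigma by split; [exact: lt_trans cs|exists z].
by have := ub_le_sup ubA As; rewrite leNgt cs.
Qed.

End global_solution.

Lemma gradient_comp (R : realType) n (Q : R -> R) (dQ : R) (V : 'cV[R]_n -> R) y :
  differentiable V y -> is_derive (V y) 1 Q dQ ->
  differentiable (Q \o V) y /\ gradient (Q \o V) y = dQ *: gradient V y.
Proof.
move=> dV HQ.
have dQV : differentiable Q (V y) by apply/derivable1_diffP; exact: ex_derive.
have dW : differentiable (Q \o V) y by exact: differentiable_comp.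
split => //; apply/rowP => j; rewrite !mxE !deriveE// diff_comp//= diff1E//=.
by rewrite derive1E derive_val /= mulrC.
Qed.

(** * Vanishing of closed-loop solutions by the predefined time *)

Section settling_time.
Context {R : realType} {n : nat}.
Local Notation Lam := (@completed_lebesgue_measure R).
Variables (S : set 'cV[R]_n) (V : 'cV[R]_n -> R) (Phi : 'cV[R]_n -> 'cV[R]_n).
Hypothesis BU : blows_up_at_boundary S V.
Hypothesis dV : forall y, S y -> differentiable V y.
Hypothesis cV : forall y, S y -> {for y, continuous (gradient V)}.
Variables (alpha beta p q r : R) (Tp : R).
Hypotheses (alpha0 : 0 < alpha) (beta0 : 0 < beta)
  (r0 : 0 < r) (pr : p * r < 1) (qr : 1 < q * r) (Tp0 : 0 < Tp).
Hypothesis Vpos : forall y, S y -> y != 0 -> 0 < V y.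
Hypothesis decay : forall y, S y -> (gradient V y *m Phi y) 0 0 <=
  - (predefined_time_gain alpha beta p q r / Tp) * decay_rate alpha beta p q r (V y).

Let gain0 : 0 < predefined_time_gain alpha beta p q r.
Proof. exact: predefined_time_gain_gt0. Qed.

Let decay_le0 y : S y -> (gradient V y *m Phi y) 0 0 <= 0.
Proof.
move=> Sy; apply: (le_trans (decay Sy)); rewrite mulNr oppr_le0.
by rewrite mulr_ge0 ?powR_ge0// divr_ge0// ltW.
Qed.

Lemma continuous_decay_rate (v : R) : 0 < v ->
  {for v, continuous (decay_rate alpha beta p q r)}.
Proof.
move=> v0.
have cpow (w s : R) : 0 < w -> {for w, continuous (fun v => v `^ s)}.
  move=> w0; apply: (@differentiable_continuous _ _ _ w (fun v => v `^ s)).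
  apply/derivable1_diffP; exact: (@ex_derive _ _ _ _ _ _ _ (is_derive1_powR s w0)).
have W0 : 0 < alpha * v `^ p + beta * v `^ q by rewrite addr_gt0// mulr_gt0// powR_gt0.
apply: (@cvg_comp _ _ _ (fun v => alpha * v `^ p + beta * v `^ q) (fun v => v `^ r)
   _ (nbhs (alpha * v `^ p + beta * v `^ q))); last exact: cpow.
apply: cvgD; apply: cvgM; (try exact: cvg_cst); exact: cpow.
Qed.

(* As long as [V (x t) > 0], the quantity [Q (V (x t))] lies between 0 and the
   gain and decreases at least at the rate [gain / Tp]. *)
Lemma solution_vanishes x0 (x : R -> 'cV[R]_n) : S x0 ->
  solution_on Phi x0 +oo%E x -> vanishes_from Tp x.
Proof.
move=> Sx0 sx T TpT.
have T0 : 0 <= T by rewrite (le_trans (ltW Tp0)).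
have Tt : (T%:E < +oo)%E by exact: ltry.
have stay t : 0 <= t -> S (x t).
  by move=> t0; have [] := solution_stays BU dV cV decay_le0 Sx0 sx t0 (ltry _).
apply/eqP; apply/negPn/negP => xT0.
have VT0 : 0 < V (x T) by apply: Vpos => //; exact: stay.
have [gi xE] := solution_segment sx T0 Tt.
(* Monotonicity keeps [V] above the positive value [V (x T)] on the whole segment, so [Q] is applied
   only where it is controlled. *)
have Vmono s : 0 <= s <= T -> V (x T) <= V (x s).
  move=> /andP[s0 sT].
  rewrite (solution_energy dV cV sx T0 Tt); last by move=> t /andP[/stay].
  rewrite (solution_energy dV cV sx s0 (ltry _)); last by move=> t /andP[/stay].
  rewrite lerD2l -subr_le0 Rintegral_segB//; last first.
    apply: (integrable_mulmx_curve gi xE) => t /andP[t0 _]; apply: cV; exact: stay.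
  rewrite -oppr_ge0 -mulN1r -RintegralZl; last 2 first.
    exact: measurable_line (measurable_itv _).
    apply: integrable_segoc => //; apply: (integrable_mulmx_curve gi xE) => t /andP[t0 _].
    apply: cV; exact: stay.
  apply: Rintegral_ge0 => t; rewrite /= in_itv/= => /andP[st tT].
  by rewrite mulN1r oppr_ge0; apply: decay_le0; apply: stay; rewrite (le_trans s0) ?ltW.
have Vx0 s : 0 <= s <= T -> 0 < V (x s) by move=> sT; exact: lt_le_trans (Vmono s sT).
have [Q QP] := settling_function alpha0 beta0 r0 pr qr.
pose W := Q \o V.
have WP y : S y -> 0 < V y -> differentiable W y /\
    gradient W y = (decay_rate alpha beta p q r (V y))^-1 *: gradient V y.
  by move=> Sy Vy; apply: gradient_comp; [exact: dV|exact: (QP _ Vy).1].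
have oS := blows_up_open BU.
have cW s : 0 <= s <= T -> {for x s, continuous (gradient W)}.
  move=> sT; have Sxs : S (x s) by apply: stay; case/andP: sT.
  have cVxs : {for x s, continuous V} by exact: differentiable_continuous (dV Sxs).
  have nearP : \forall z \near x s, S z /\ 0 < V z.
    have nV : \forall z \near x s, 0 < V z by apply: (cvgr_gt _ cVxs); exact: Vx0.
    have nS : \forall z \near x s, S z by exact: open_nbhs_nbhs.
    by near do split.
  apply: (near_eq_continuous_at
      (f := fun z => (decay_rate alpha beta p q r (V z))^-1 *: gradient V z)).
    by apply: filterS nearP => z [Sz Vz]; rewrite (WP z Sz Vz).2.
  have cR : (decay_rate alpha beta p q r (V z))^-1 @[z --> x s] -->
      (decay_rate alpha beta p q r (V (x s)))^-1.
    apply: (cvg_comp V (fun v => (decay_rate alpha beta p q r v)^-1) cVxs).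
    apply: cvgV; first by rewrite gt_eqF// decay_rate_gt0// Vx0.
    exact: continuous_decay_rate (Vx0 s sT).
  exact: (continuous_scalemx_at cR (cV Sxs)).
have dW s : 0 <= s <= T -> differentiable W (x s).
  by move=> sT; apply: (WP _ _ (Vx0 s sT)).1; apply: stay; case/andP: sT.
have WT := chain_rule T0 gi xE dW cW.
have intW := integrable_mulmx_curve gi xE cW.
pose gamma := predefined_time_gain alpha beta p q r.
have : \int[Lam]_(s in `[0, T]) (gradient W (x s) *m Phi (x s)) 0 0 <=
    - (gamma / Tp) * T.
  have -> : - (gamma / Tp) * T = \int[Lam]_(s in `[0, T]) (- (gamma / Tp)).
    rewrite Rintegral_cst; last exact: measurable_line (measurable_itv _).
    have -> : fine (Lam `[0, T]) = T; last by [].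
    by rewrite completed_itvcc// subr0.
  apply: le_Rintegral => //.
  - exact: measurable_line (measurable_itv _).
  - apply: measurable_bounded_integrable => //.
    + exact: measurable_line (measurable_itv _).
    + have : (Lam `[0%R, T] < +oo)%E; last by [].
      by rewrite completed_itvcc// ltry.
    + by exists `|- (gamma / Tp)|; split => [|N MN s _]; rewrite ?num_real//= ltW.
  - move=> s; rewrite /= in_itv/= => sT.
    have Sxs : S (x s) by apply: stay; case/andP: sT.
    have Vs := Vx0 s sT.
    rewrite (WP _ Sxs Vs).2 -scalemxAl mxE.
    rewrite mulrC ler_pdivrMr ?decay_rate_gt0//.
    exact: decay.
move=> le_int.
(* [W] starts at or below the gain and loses at least [gamma / Tp * T], which is no less than the
   gain since [T >= Tp]. *)
have Wneg : W (x T) <= 0.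
  have W0 : W (x 0) <= gamma.
    by have [_ /andP[]] := QP _ (Vx0 0 (introT andP (conj (lexx _) T0))).
  have gT : gamma <= gamma / Tp * T.
    by rewrite mulrAC ler_pdivlMr// ler_pM2l.
  rewrite WT; apply: (le_trans (lerD W0 le_int)).
  by rewrite mulNr subr_le0.
(* Since [Q] is only known to be nonnegative, the value 0 is not yet absurd. By the mean value
   theorem [Q] is strictly smaller at half the argument, where it would have to be negative. *)
have h0 : 0 < V (x T) / 2 by rewrite divr_gt0.
have hlt : V (x T) / 2 < V (x T) by rewrite gtr_pMr// invf_lt1// ltr1n.
have dQ v : 0 < v -> derivable Q v 1.
  by move=> v0; have [dQv _] := QP v v0; exact: ex_derive.
have [] := @MVT R Q (fun v => (decay_rate alpha beta p q r v)^-1) _ _ hlt.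
- move=> v; rewrite in_itv/= => /andP[hv _].
  by have [] := QP v (lt_trans h0 hv).
- apply: derivable_within_continuous => v; rewrite in_itv/= => /andP[hv _].
  exact: dQ (lt_le_trans h0 hv).
move=> v; rewrite in_itv/= => /andP[hv _] QE.
have : 0 < Q (V (x T)) - Q (V (x T) / 2).
  by rewrite QE mulr_gt0 ?subr_gt0// invr_gt0 decay_rate_gt0// (lt_trans h0).
have [_ /andP[Q0 _]] := QP _ h0.
by rewrite subr_gt0 => /(le_lt_trans Q0); rewrite ltNge Wneg.
Unshelve. all: end_near. Qed.

End settling_time.

(** * The game *)

Section algebra.
Context {R : realType}.

(** Symmetry of [M] merges the two cross terms. The scalar [c] lets one identity serve both players:
    it is [- 2^-1] for the control and [2^-1] for the adversary. *)
Lemma complete_square m (M : 'M[R]_m) (w : 'rV[R]_m) (c : R) (u : 'cV[R]_m) :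
  symmetric_posdef M ->
  let us := c *: (invmx M *m w^T) in
  ((u - us)^T *m M *m (u - us)) 0 0 =
  (u^T *m M *m u) 0 0 - 2 * c * (w *m u) 0 0 + (us^T *m M *m us) 0 0.
Proof.
move=> pM us; have [MT _] := pM; have Mu := posdef_unitmx pM.
have Mus : M *m us = c *: w^T by rewrite /us -scalemxAr mulmxA mulmxV// mul1mx.
have usM : us^T *m M = c *: w.
  by rewrite -[M in LHS]MT -trmx_mul Mus linearZ/= trmxK.
have -> : (u - us)^T = u^T - us^T by rewrite linearB.
rewrite !mulmxBl !mulmxBr -(mulmxA u^T M us) Mus usM.
have addE (A B : 'M[R]_1) : (A + B) 0 0 = A 0 0 + B 0 0 by rewrite mxE.
have oppE (A : 'M[R]_1) : (- A) 0 0 = - A 0 0 by rewrite mxE.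
have scaleE a (A : 'M[R]_1) : (a *: A) 0 0 = a * A 0 0 by rewrite mxE.
rewrite -!scalemxAr -!scalemxAl !(addE, oppE, scaleE).
have -> : (u^T *m w^T) 0 0 = (w *m u) 0 0 by rewrite -trmx_mul mxE.
ring.
Qed.

End algebra.

Section integrals.
Context d (T : measurableType d) (R : realType) (mu : {measure set T -> \bar R}).

(* Integrability is not needed since [+oo - +oo = -oo]. *)
Lemma le_integral_measurable (D : set T) (f g : T -> \bar R) :
  measurable D -> measurable_fun D f -> measurable_fun D g ->
  (forall t, D t -> (f t <= g t)%E) ->
  (\int[mu]_(t in D) f t <= \int[mu]_(t in D) g t)%E.
Proof.
move=> mD mf mg fg; rewrite integralE [leRHS]integralE.
apply: leeB; apply: ge0_le_integral => //; try exact: measurable_funepos;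
  try exact: measurable_funeneg.
- by move=> t Dt; rewrite !funeposE ge_max !le_max fg//= lexx orbT.
- by move=> t Dt; rewrite !funenegE ge_max !le_max leeN2 fg//= lexx orbT.
Qed.

Lemma measurable_quadratic (D : set T) m (M : T -> 'M[R]_m) (v : T -> 'cV[R]_m) :
  (forall i j, measurable_fun D (fun t => M t i j)) ->
  (forall i, measurable_fun D (fun t => v t i 0)) ->
  measurable_fun D (fun t => ((v t)^T *m M t *m v t) 0 0).
Proof.
move=> mM mv.
have -> : (fun t => ((v t)^T *m M t *m v t) 0 0) =
    (fun t => \sum_j (\sum_i v t i 0 * M t i j) * v t j 0).
  apply/funext => t; rewrite mxE; apply: eq_bigr => j _; rewrite mxE.
  by congr (_ * _); apply: eq_bigr => i _; rewrite mxE.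
apply: measurable_sum => j; apply: measurable_funM => //.
by apply: measurable_sum => i; exact: measurable_funM.
Qed.
End integrals.

Section open_sets.
Context {R : realType} {n : nat}.

Lemma continuous_open (S : set 'cV[R]_n) (U : topologicalType) (f : 'cV[R]_n -> U) :
  open S -> {within S, continuous f} -> forall y, S y -> {for y, continuous f}.
Proof.
move=> oS /subspace_continuousP cf y Sy.
have := cf y Sy; rewrite within_interior//.
by move: oS; rewrite openE; apply.
Qed.

(** A small step against the gradient cannot decrease [V], so the first-order expansion bounds the
    sum of squares of the partial derivatives by [e] times the norm of the gradient, for every
    [e > 0]. *)
Lemma gradient_at_min (V : 'cV[R]_n -> R) (y : 'cV[R]_n) :
  differentiable V y -> (\forall z \near y, V y <= V z) -> gradient V y = 0.
Proof.
move=> dV /nbhs_ballP[d /= d0 dmin].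
pose v := (gradient V y)^T.
have N0 : 0 <= `|v| by [].
have sqE : (gradient V y *m v) 0 0 = \sum_j (gradient V y 0 j) ^+ 2.
  by rewrite mxE; apply: eq_bigr => j _; rewrite !mxE expr2.
have sq_le (e : R) : 0 < e -> (gradient V y *m v) 0 0 <= e * `|v|.
  move=> e0; have [d' d'0 dP] := differentiable_first_order dV e0.
  (* The step [eta *: v] stays within both the radius of minimality and that of the expansion; the
     added 1 avoids a division by zero. *)
  pose eta := Num.min d d' / (`|v| + 1).
  have m0 : 0 < Num.min d d' by rewrite lt_min d0.
  have v1 : 0 < `|v| + 1 by rewrite ltr_wpDl.
  have eta0 : 0 < eta by rewrite divr_gt0.
  have etav : eta * `|v| < Num.min d d'.
    by rewrite /eta mulrAC ltr_pdivrMr// ltr_pM2l// ltrDl.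
  have zyE : y - eta *: v - y = - (eta *: v) by rewrite addrAC subrr add0r.
  have zy : `|y - eta *: v - y| = eta * `|v|.
    by rewrite zyE normrN normrZ gtr0_norm.
  have := dP (y - eta *: v); rewrite zy zyE => dPz.
  have {}dPz := dPz (lt_le_trans etav (_ : _ <= d')); rewrite ge_min lexx orbT in dPz.
  have Vz : V y <= V (y - eta *: v).
    apply: dmin; rewrite -ball_normE /ball_/= -normrN opprB zy.
    by apply: (lt_le_trans etav); rewrite ge_min lexx.
  rewrite -(ler_pM2l eta0); apply: le_trans (_ : e * (eta * `|v|) <= _); last first.
    by rewrite mulrCA.
  apply: le_trans (dPz isT); apply: le_trans (ler_norm _).
  have -> : (gradient V y *m - (eta *: v)) 0 0 = - (eta * (gradient V y *m v) 0 0).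
    by rewrite mulmxN -scalemxAr 2!mxE.
  by rewrite opprK lerDr subr_ge0.
have sq0 : (gradient V y *m v) 0 0 <= 0.
  apply/ler_addgt0Pr => e e0; rewrite add0r.
  have v1 : 0 < `|v| + 1 by rewrite ltr_wpDl.
  apply: (le_trans (sq_le (e / (`|v| + 1)) (divr_gt0 e0 v1))).
  by rewrite mulrAC ler_pdivrMr// ler_pM2l// lerDl.
apply/rowP => j; rewrite [RHS]mxE; apply/eqP; rewrite -sqrf_eq0.
rewrite sqE in sq0.
rewrite eq_le sqr_ge0 andbT (le_trans _ sq0)// (bigD1 j)//= lerDl.
by apply: sumr_ge0 => i _; exact: sqr_ge0.
Qed.

Lemma dist_mem (S : set 'cV[R]_n) y : S y -> dist y S = 0.
Proof.
move=> Sy; rewrite /dist.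
set A := [set _ | _ in _].
have A0 : A 0 by exists y => //; rewrite subrr normr0.
have lbA : lbound A 0 by move=> _ [z _ <-].
apply/le_anti; rewrite ge_inf//=; last by exists 0.
by apply: lb_le_inf => //; exists 0.
Qed.

Lemma continuous_lebesgue_measurable m (S : set 'cV[R]_n) (k : 'cV[R]_n -> 'cV[R]_m) :
  open S -> (forall y, S y -> {for y, continuous k}) ->
  lebesgue_measurable_on S k.
Proof.
move=> oS ck A oA; exists (S `&` k @^-1` A), set0; split.
- apply: sub_sigma_algebra; rewrite /= openE => y [Sy Ay].
  apply: filterI; first by move: oS; rewrite openE; apply.
  by apply: (ck y Sy); exact: open_nbhs_nbhs.
- move=> e e0; exists set0, (fun=> 0), (fun=> 0); split => //.
  by rewrite esum_set0 lte_fin.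
- by rewrite setU0.
Qed.

End open_sets.

Section game.
Context {R : realType} {n mu ma : nat}.
Local Notation Lam := (@completed_lebesgue_measure R).
Variables (S : set 'cV[R]_n) (V : 'cV[R]_n -> R).
Variables (Lu : 'cV[R]_n -> 'rV[R]_mu) (La : 'cV[R]_n -> 'rV[R]_ma).
Variables (Ru : 'cV[R]_n -> 'M[R]_mu) (Ra : 'cV[R]_n -> 'M[R]_ma).
Variables (f : 'cV[R]_n -> 'cV[R]_n) (G : 'cV[R]_n -> 'M[R]_(n, mu))
  (K : 'cV[R]_n -> 'M[R]_(n, ma)).
Hypothesis oS : open S.
Hypothesis dV : forall y, S y -> differentiable V y.
Hypothesis cV : forall y, S y -> {for y, continuous (gradient V)}.
Hypothesis cLu : forall y, S y -> {for y, continuous Lu}.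
Hypothesis cLa : forall y, S y -> {for y, continuous La}.
Hypothesis cRu : forall y, S y -> {for y, continuous Ru}.
Hypothesis cRa : forall y, S y -> {for y, continuous Ra}.
Hypothesis pRu : forall y, S y -> symmetric_posdef (Ru y).
Hypothesis pRa : forall y, S y -> symmetric_posdef (Ra y).
Hypotheses (cf : continuous f) (cG : continuous G) (cK : continuous K).

Let us y := - 2^-1 *: (invmx (Ru y) *m (Lu y + gradient V y *m G y)^T).
Let as_ y := 2^-1 *: (invmx (Ra y) *m (La y + gradient V y *m K y)^T).
Let F y u a := f y + G y *m u + K y *m a.
Let L y := ((us y)^T *m Ru y *m us y) 0 0 - (gradient V y *m f y) 0 0
   - ((as_ y)^T *m Ra y *m as_ y) 0 0.

(** On the right, the terms free of [u] and [a] are exactly [L y]: the two constants left by the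
    completed squares and the derivative of [V] along the drift. The terms in [G] and [K] cancel
    against the cross terms. *)
Lemma running_cost y u a : S y ->
  L y + (Lu y *m u) 0 0 + (La y *m a) 0 0 + (u^T *m Ru y *m u) 0 0
    - (a^T *m Ra y *m a) 0 0 =
  - (gradient V y *m F y u a) 0 0
  + ((u - us y)^T *m Ru y *m (u - us y)) 0 0
  - ((a - as_ y)^T *m Ra y *m (a - as_ y)) 0 0.
Proof.
move=> Sy; rewrite (complete_square _ _ _ (pRu Sy)) (complete_square _ _ _ (pRa Sy)).
rewrite -/(us y) -/(as_ y) /L /F.
have addE m (A B : 'M[R]_(1, m)) j : (A + B) 0 j = A 0 j + B 0 j by rewrite mxE.
rewrite !mulmxDr !mulmxDl !addE !mulmxA.
by field.
Qed.

(** Identifies the bracket of the decay hypothesis with the closed-loop field. *)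
Lemma closed_loop_field y : F y (us y) (as_ y) =
  f y
  - 2^-1 *: (G y *m invmx (Ru y) *m (Lu y)^T)
  + 2^-1 *: (K y *m invmx (Ra y) *m (La y)^T)
  - 2^-1 *: (G y *m invmx (Ru y) *m (G y)^T *m (gradient V y)^T)
  + 2^-1 *: (K y *m invmx (Ra y) *m (K y)^T *m (gradient V y)^T).
Proof.
have trD m (A B : 'rV[R]_m) : (A + B)^T = A^T + B^T by rewrite linearD.
rewrite /F /us /as_ -!scalemxAr !trD !mulmxDr !trmx_mul !mulmxA.
rewrite !scalerDr !scaleNr -!addrA; congr (_ + _); congr (_ + _).
by rewrite [LHS]addrCA.
Qed.

Lemma continuous_saddle_control y : S y -> {for y, continuous us}.
Proof.
move=> Sy; apply: (continuous_scalemx_at (k := fun=> - 2^-1)).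
  exact: continuous_cst_at.
apply: continuous_mulmx_at.
  by apply: continuous_invmx_at; [exact: posdef_unitmx (pRu Sy)|exact: cRu].
apply: continuous_trmx_at; apply: continuous_addmx_at; first exact: cLu.
by apply: continuous_mulmx_at; [exact: cV|exact: cG].
Qed.

Lemma continuous_saddle_adversary y : S y -> {for y, continuous as_}.
Proof.
move=> Sy; apply: (continuous_scalemx_at (k := fun=> 2^-1)).
  exact: continuous_cst_at.
apply: continuous_mulmx_at.
  by apply: continuous_invmx_at; [exact: posdef_unitmx (pRa Sy)|exact: cRa].
apply: continuous_trmx_at; apply: continuous_addmx_at; first exact: cLa.
by apply: continuous_mulmx_at; [exact: cV|exact: cK].
Qed.

Lemma continuous_closed_loop y : S y -> {for y, continuous (closed_loop F us as_)}.
Proof.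
move=> Sy; apply: continuous_addmx_at; first apply: continuous_addmx_at.
- exact: cf.
- by apply: continuous_mulmx_at; [exact: cG|exact: continuous_saddle_control].
- by apply: continuous_mulmx_at; [exact: cK|exact: continuous_saddle_adversary].
Qed.

Section cost_bounds.
Variables (Tp : R) (Tp0 : 0 < Tp) (x0 : 'cV[R]_n) (x : R -> 'cV[R]_n).
Hypothesis x_in : forall t, 0 <= t -> S (x t).

Lemma measurable_on_curve (Phi : 'cV[R]_n -> 'cV[R]_n) (h : 'cV[R]_n -> R) :
  solution_on Phi x0 +oo%E x ->
  (forall y, S y -> {for y, continuous h}) ->
  measurable_fun (`[0%R, Tp] : set (@lebesgue_line R)) (h \o x).
Proof.
move=> sx ch; have [gi xE] := solution_segment sx (ltW Tp0) (ltry _).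
have [|//] := @segment_bounded_measurable R Tp (h \o x).
apply: (continuous_on_curve gi xE) => t /andP[t0 _].
by apply: ch; exact: x_in.
Qed.

(** A Lebesgue measurable law composed with a continuous curve may fail to be measurable; here
    measurability comes from the admissibility of the signal played. *)
Lemma measurable_deviation m (Phi : 'cV[R]_n -> 'cV[R]_n)
    (M : 'cV[R]_n -> 'M[R]_m) (k kstar : 'cV[R]_n -> 'cV[R]_m) :
  solution_on Phi x0 +oo%E x ->
  (forall y, S y -> {for y, continuous M}) ->
  (forall y, S y -> {for y, continuous kstar}) ->
  admissible_signal (k \o x) ->
  measurable_fun (`[0%R, Tp] : set (@lebesgue_line R)) (fun t =>
    ((k (x t) - kstar (x t))^T *m M (x t) *m (k (x t) - kstar (x t))) 0 0).
Proof.
move=> sx cM ck adm; apply: measurable_quadratic => [i j|i].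
  apply: (measurable_on_curve sx (h := fun y => M y i j)) => y Sy.
  exact: (continuous_mxP _ _).1 (cM y Sy) i j.
have -> : (fun t => (k (x t) - kstar (x t)) i 0) =
    (fun t => k (x t) i 0 - kstar (x t) i 0).
  by apply/funext => t; rewrite !mxE.
apply: measurable_funB.
  apply: measurable_funS (adm i); first exact: measurable_line (measurable_itv _).
  by move=> t /=; rewrite !in_itv/= => /andP[->].
apply: (measurable_on_curve sx (h := fun y => kstar y i 0)) => y Sy.
exact: (continuous_mxP _ _).1 (ck y Sy) i 0.
Qed.

Variables (u : 'cV[R]_n -> 'cV[R]_mu) (a : 'cV[R]_n -> 'cV[R]_ma).
Hypothesis sx : solution_on (closed_loop F u a) x0 +oo%E x.
Hypotheses (admu : admissible_signal (u \o x)) (adma : admissible_signal (a \o x)).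

Let P t := (gradient V (x t) *m closed_loop F u a (x t)) 0 0.

Let P_integrable : Lam.-integrable `[0, Tp] (EFin \o P).
Proof.
have [gi xE] := solution_segment sx (ltW Tp0) (ltry _).
by apply: (integrable_mulmx_curve gi xE) => t /andP[t0 _]; apply: cV; exact: x_in.
Qed.

Let energy_balance :
  (\int[Lam]_(t in `[0%R, Tp]) (- P t)%:E = (V x0 - V (x Tp))%:E)%E.
Proof.
have mI : measurable (`[0, Tp] : set (@lebesgue_line R)).
  exact: measurable_line (measurable_itv _).
have -> : V (x Tp) = V x0 + \int[Lam]_(t in `[0, Tp]) P t.
  by apply: (solution_energy dV cV sx (ltW Tp0) (ltry _)) => t /andP[/x_in].
rewrite opprD addrA subrr add0r -mulN1r -RintegralZl// /Rintegral fineK.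
  by apply: eq_integral => t _; rewrite mulN1r.
by apply: integrable_fin_num => //; exact: integrableZl P_integrable.
Qed.

Let integrand t := L (x t) + (Lu (x t) *m u (x t)) 0 0 + (La (x t) *m a (x t)) 0 0
  + ((u (x t))^T *m Ru (x t) *m u (x t)) 0 0
  - ((a (x t))^T *m Ra (x t) *m a (x t)) 0 0.

Let measurable_P :
  measurable_fun (`[0%R, Tp] : set (@lebesgue_line R)) (fun t => - P t).
Proof.
apply: measurable_funN; apply/measurable_EFinP; exact: measurable_int P_integrable.
Qed.

Let measurable_integrand :
  measurable_fun (`[0%R, Tp] : set (@lebesgue_line R)) integrand.
Proof.
have mdev : measurable_fun (`[0%R, Tp] : set (@lebesgue_line R)) (fun t => - P t
  + ((u (x t) - us (x t))^T *m Ru (x t) *m (u (x t) - us (x t))) 0 0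
  - ((a (x t) - as_ (x t))^T *m Ra (x t) *m (a (x t) - as_ (x t))) 0 0).
  have mu_ := measurable_deviation sx cRu continuous_saddle_control admu.
  have ma_ := measurable_deviation sx cRa continuous_saddle_adversary adma.
  exact: (measurable_funB (measurable_funD measurable_P mu_) ma_).
apply: eq_measurable_fun mdev => t; rewrite inE/= in_itv/= => /andP[t0 _].
by rewrite /integrand running_cost//; exact: x_in.
Qed.

(** The square of the adversary vanishes, so the running cost dominates [- P], whose integral is the
    drop of [V]. For [u = us] the roles and the inequality are exchanged. *)
Lemma cost_ge_value : a = as_ ->
  ((V x0 - V (x Tp))%:E <= cost Tp L Lu La Ru Ra x (u \o x) (a \o x))%E.
Proof.
move=> aE; rewrite -energy_balance; apply: le_integral_measurable.
- exact: measurable_line (measurable_itv _).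
- exact/measurable_EFinP.
- exact/measurable_EFinP.
move=> t; rewrite /= in_itv/= => /andP[t0 _]; have Sxt := x_in t0.
have quad0 : ((a (x t) - as_ (x t))^T *m Ra (x t) *m (a (x t) - as_ (x t))) 0 0 = 0.
  by rewrite aE subrr mulmx0 mxE.
rewrite lee_fin running_cost// quad0 subr0 lerDl.
exact: posdef_ge0 (pRu Sxt).
Qed.

Lemma cost_le_value : u = us ->
  (cost Tp L Lu La Ru Ra x (u \o x) (a \o x) <= (V x0 - V (x Tp))%:E)%E.
Proof.
move=> uE; rewrite -energy_balance; apply: le_integral_measurable.
- exact: measurable_line (measurable_itv _).
- exact/measurable_EFinP.
- exact/measurable_EFinP.
move=> t; rewrite /= in_itv/= => /andP[t0 _]; have Sxt := x_in t0.
have quad0 : ((u (x t) - us (x t))^T *m Ru (x t) *m (u (x t) - us (x t))) 0 0 = 0.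
  by rewrite uE subrr mulmx0 mxE.
rewrite lee_fin running_cost// quad0 addr0 gerBl.
exact: posdef_ge0 (pRa Sxt).
Qed.

End cost_bounds.

End game.

Lemma measurable_fun_halfline (R : realType) (h : R -> R) :
  (forall T : R, 0 < T ->
    measurable_fun (`[0%R, T] : set (@lebesgue_line R)) (h : @lebesgue_line R -> R)) ->
  measurable_fun (`[0%R, +oo[ : set (@lebesgue_line R)) (h : @lebesgue_line R -> R).
Proof.
move=> mh.
have -> : (`[0%R, +oo[%classic : set R) = \bigcup_k `[0%R, k.+1%:R]%classic.
  apply/seteqP; split=> t; last by move=> [k _] /=; rewrite !in_itv/= => /andP[->].
  rewrite /= in_itv/= andbT => t0; exists (Num.bound t) => //=.
  by rewrite in_itv/= t0 (le_trans (ltW (archi_boundP t0)))// ler_nat.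
apply/measurable_fun_bigcup => k; first exact: measurable_line (measurable_itv _).
exact: (mh _ (ltr0Sn _ _)).
Qed.

Theorem corollary4p2 (R : realType) (n mu ma Nf NG NK : nat)
  (f : 'cV[R]_n -> 'cV[R]_Nf -> 'cV[R]_n)
  (G : 'cV[R]_n -> 'cV[R]_NG -> 'M[R]_(n, mu))
  (K : 'cV[R]_n -> 'cV[R]_NK -> 'M[R]_(n, ma))
  (f_cont : forall theta, continuous (f^~ theta))
  (G_cont : forall theta, continuous (G^~ theta))
  (K_cont : forall theta, continuous (K^~ theta))
  (f_zero : forall theta, f 0 theta = 0)
  (S : set 'cV[R]_n) (S0 : S 0) (Tp : R) (Tp_gt0 : 0 < Tp)
  (V : 'cV[R]_n -> R)
  (Lu : 'cV[R]_n -> 'rV[R]_mu) (La : 'cV[R]_n -> 'rV[R]_ma)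
  (Ru : 'cV[R]_n -> 'M[R]_mu) (Ra : 'cV[R]_n -> 'M[R]_ma)
  (thf : 'cV[R]_Nf) (thG : 'cV[R]_NG) (thK : 'cV[R]_NK)
  (alpha beta p q r : R) :
  let ths := (thf, thG, thK) in
  let F := dynamics f G K ths in
  let ustar := saddle_control V Lu Ru G in
  let astar := saddle_adversary V La Ra K in
  let phi x (th : ('cV[R]_Nf * 'cV[R]_NG * 'cV[R]_NK) * 'cV[R]_NG * 'cV[R]_NK) :=
    closed_loop (dynamics f G K th.1.1) (ustar^~ th.1.2) (astar^~ th.2) x in
  let L x : R := (((ustar x thG)^T *m Ru x *m ustar x thG) 0 0
                  - (gradient V x *m f x thf) 0 0
                  - ((astar x thK)^T *m Ra x *m astar x thK) 0 0) in
  let J := payoff F (cost Tp L Lu La Ru Ra) in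
  (forall x0, S x0 -> stabilizing_pairs F S Tp x0 !=set0) ->
  continuously_differentiable S V ->
  {within S, continuous Lu} -> {within S, continuous La} ->
  Lu 0 = 0 -> La 0 = 0 ->
  {within S, continuous Ru} -> {within S, continuous Ra} ->
  (forall x, S x -> symmetric_posdef (Ru x)) ->
  (forall x, S x -> symmetric_posdef (Ra x)) ->
  0 < alpha -> 0 < beta -> 0 < p -> 0 < q -> 0 < r ->
  p * r < 1 -> 1 < q * r ->
  V 0 = 0 -> (forall x, S x -> x != 0 -> 0 < V x) ->
  blows_up_at_boundary S V ->
  (forall x, S x ->
    (gradient V x *m
      (f x thf
       - 2^-1 *: (G x thG *m invmx (Ru x) *m (Lu x)^T)
       + 2^-1 *: (K x thK *m invmx (Ra x) *m (La x)^T)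
       - 2^-1 *: (G x thG *m invmx (Ru x) *m (G x thG)^T *m (gradient V x)^T)
       + 2^-1 *: (K x thK *m invmx (Ra x) *m (K x thK)^T *m (gradient V x)^T)))
      0 0
    <= - (predefined_time_gain alpha beta p q r / Tp)
       * (alpha * V x `^ p + beta * V x `^ q) `^ r) ->
  bounded_set S \/ (~ bounded_set S /\ coercive S V) ->
  (* standing assumption on the solutions of the closed-loop system *)
  (forall x0, S x0 ->
    locally_solvable (closed_loop F (ustar^~ thG) (astar^~ thK)) x0 /\
    uniquely_solvable (closed_loop F (ustar^~ thG) (astar^~ thK)) x0) ->
  safely_predefined_time_stable_at S Tp phi (ths, thG, thK) /\
  forall x0, S x0 ->
    [/\ stabilizing_pairs F S Tp x0 (ustar^~ thG, astar^~ thK),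
        (forall Fu Fa, Fu `*` Fa = stabilizing_pairs F S Tp x0 ->
           is_min_max Fu Fa (J x0) (J x0 (ustar^~ thG) (astar^~ thK)) /\
           is_max_min Fu Fa (J x0) (J x0 (ustar^~ thG) (astar^~ thK))) &
        J x0 (ustar^~ thG) (astar^~ thK) = (V x0)%:E].
Proof.
move=> ths F ustar astar phi L J _ [dV cVw] cLuw cLaw Lu0 La0 cRuw cRaw pRu pRa
  alpha0 beta0 _ _ r0 pr qr V0 Vpos BU decayH bV standing.
have oS := blows_up_open BU.
have bV' : bounded_set S \/ coercive S V by case: bV => [|[]]; [left|right].
have cV := continuous_open oS cVw.
have cLu := continuous_open oS cLuw.
have cLa := continuous_open oS cLaw.
have cRu := continuous_open oS cRuw.
have cRa := continuous_open oS cRaw.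
have cus := continuous_saddle_control cV cLu cRu pRu (G_cont thG).
have cas := continuous_saddle_adversary cV cLa cRa pRa (K_cont thK).
pose Phi := closed_loop F (ustar^~ thG) (astar^~ thK).
have cPhi y : S y -> {for y, continuous Phi}.
  exact: (continuous_closed_loop cV cLu cLa cRu cRa pRu pRa (f_cont thf)
    (G_cont thG) (K_cont thK)).
have decay y : S y -> (gradient V y *m Phi y) 0 0 <=
    - (predefined_time_gain alpha beta p q r / Tp) * decay_rate alpha beta p q r (V y).
  move=> Sy; have := decayH y Sy.
  by rewrite -(closed_loop_field V Lu La Ru Ra (f^~ thf) (G^~ thG) (K^~ thK) y).
have gain0 := predefined_time_gain_gt0 alpha0 beta0 r0 pr qr.
have decay_le0 y : S y -> (gradient V y *m Phi y) 0 0 <= 0.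
  move=> Sy; apply: (le_trans (decay y Sy)); rewrite mulNr oppr_le0.
  by rewrite mulr_ge0 ?powR_ge0// divr_ge0// ltW.
(* The origin is an interior minimum of [V]. With [Lu 0 = 0] and [La 0 = 0] this makes both
   strategies vanish there, so that they are feedback laws and 0 is an equilibrium. *)
have gradV0 : gradient V 0 = 0.
  apply: gradient_at_min; first exact: dV.
  have : \forall z \near (0 : 'cV[R]_n), S z by exact: open_nbhs_nbhs.
  apply: filterS => z Sz; rewrite V0; have [->|z0] := eqVneq z 0; first by rewrite V0.
  exact: ltW (Vpos z Sz z0).
have us0 th : ustar 0 th = 0.
  by rewrite /ustar /saddle_control Lu0 gradV0 mul0mx addr0 trmx0 mulmx0 scaler0.
have as0 th : astar 0 th = 0.
  by rewrite /astar /saddle_adversary La0 gradV0 mul0mx addr0 trmx0 mulmx0 scaler0.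
have sol x0 : S x0 -> is_the_solution Phi x0 (the_solution Phi x0).
  move=> Sx0; have [_ uniq] := standing x0 Sx0.
  have loc y : S y -> locally_solvable Phi y by move=> /standing[].
  have [x sx] := global_solution BU dV cV bV' cPhi decay_le0 Sx0 loc uniq.
  by apply: getPex; exists x.
have stay x0 : S x0 -> remains_in S (the_solution Phi x0).
  move=> Sx0 t t0; have [sx _] := sol x0 Sx0.
  have [Sxt _] := solution_stays BU dV cV decay_le0 Sx0 sx t0 (ltry _).
  by split => //; exact: dist_mem.
have vanish x0 : S x0 -> vanishes_from Tp (the_solution Phi x0).
  move=> Sx0; have [sx _] := sol x0 Sx0.
  exact: (solution_vanishes BU dV cV alpha0 beta0 r0 pr qr Tp_gt0 Vpos decay Sx0 sx).
split.
  split; last by move=> x0 Sx0; split; [exact: sol|exact: stay|exact: vanish].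
  move=> th; rewrite /phi /closed_loop /dynamics f_zero us0 as0.
  by rewrite !mulmx0 !addr0.
move=> x0 Sx0.
have stab : stabilizing_pairs F S Tp x0 (ustar^~ thG, astar^~ thK).
  have [sx _] := sol x0 Sx0.
  have meas (h : 'cV[R]_n -> R) : (forall y, S y -> {for y, continuous h}) ->
     measurable_fun (`[0%R, +oo[ : set (@lebesgue_line R))
       (h \o the_solution Phi x0 : @lebesgue_line R -> R).
    move=> ch; apply: measurable_fun_halfline => T T0.
    have x_in t : 0 <= t -> S (the_solution Phi x0 t) by move=> /(stay x0 Sx0)[].
    exact: (measurable_on_curve T0 x_in sx ch).
  split=> /=.
  - by split; split; [exact: continuous_lebesgue_measurable oS cus|exact: us0|
      exact: continuous_lebesgue_measurable oS cas|exact: as0].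
  - exact: sol.
  - split=> i.
      apply: (meas (fun y => ustar y thG i 0)) => y Sy.
      exact: (continuous_mxP _ _).1 (cus y Sy) i 0.
    apply: (meas (fun y => astar y thK i 0)) => y Sy.
    exact: (continuous_mxP _ _).1 (cas y Sy) i 0.
  - exact: stay.
  - exact: vanish.
(* The trajectory is the one generated by the deviating pair itself; as that pair is stabilizing,
   [V (x Tp) = V 0 = 0] and the bound on the cost is [V x0]. *)
have ge_value u : stabilizing_pairs F S Tp x0 (u, astar^~ thK) ->
    ((V x0)%:E <= J x0 u (astar^~ thK))%E.
  move=> [_ /= [sx _] [admu adma] Sx van].
  have x_in t : 0 <= t -> S (the_solution (closed_loop F u (astar^~ thK)) x0 t).
    by move=> /Sx[].
  have := cost_ge_value dV cV cLu cLa cRu cRa pRu pRa (f := f^~ thf) (G_cont thG)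
    (K_cont thK) Tp_gt0 x_in sx admu adma erefl.
  by rewrite (van Tp (lexx _)) V0 subr0.
have le_value a : stabilizing_pairs F S Tp x0 (ustar^~ thG, a) ->
    (J x0 (ustar^~ thG) a <= (V x0)%:E)%E.
  move=> [_ /= [sx _] [admu adma] Sx van].
  have x_in t : 0 <= t -> S (the_solution (closed_loop F (ustar^~ thG) a) x0 t).
    by move=> /Sx[].
  have := cost_le_value dV cV cLu cLa cRu cRa pRu pRa (f := f^~ thf) (G_cont thG)
    (K_cont thK) Tp_gt0 x_in sx admu adma erefl.
  by rewrite (van Tp (lexx _)) V0 subr0.
have value : J x0 (ustar^~ thG) (astar^~ thK) = (V x0)%:E.
  by apply/le_anti; rewrite le_value//= ge_value.
split => // Fu Fa FE.
(* As the product is the whole set of stabilizing pairs, each factor contains the saddle law, and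
   any law of one factor may be paired with the saddle law of the other. *)
have [Fus Fas] : Fu (ustar^~ thG) /\ Fa (astar^~ thK).
  have : (Fu `*` Fa) (ustar^~ thG, astar^~ thK) by rewrite FE.
  by case.
have FuP u : Fu u -> ((V x0)%:E <= J x0 u (astar^~ thK))%E.
  by move=> Fuu; apply: ge_value; rewrite -FE.
have FaP a : Fa a -> (J x0 (ustar^~ thG) a <= (V x0)%:E)%E.
  by move=> Faa; apply: le_value; rewrite -FE.
rewrite value; split; split.
(* The outer optimum is attained at one saddle law and the inner one at the other. Elsewhere, the
   reply by the saddle law already bounds the inner supremum or infimum by the value. *)
- exists (ustar^~ thG) => //; split; first by exists (astar^~ thK).
  by move=> _ [a Faa <-]; exact: FaP.
- move=> u Fuu; apply: le_trans (FuP u Fuu) _.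
  by apply: ereal_sup_ubound; exists (astar^~ thK).
- exists (astar^~ thK) => //; split; first by exists (ustar^~ thG).
  by move=> _ [u Fuu <-]; exact: FuP.
- move=> a Faa; apply: le_trans _ (FaP a Faa).
  by apply: ereal_inf_lbound; exists (ustar^~ thG).
Qed.
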